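(* Let $\mathcal{C}$ be a monoidal category with coequalizers in which every object is coflat and left robust, and let $R$ be an algebra in $\mathcal{C}$. Then the forgetful functor $\mathfrak{U}:{}_R\mathcal{C}_R\to\mathcal{C}$, endowed with the trivial monoidal structure $\phi_2=(q^R_{X,Y})_{X,Y\in{}_R\mathcal{C}_R}$, $\phi_0=\eta_R$, is Frobenius monoidal (i.e. admits an opmonoidal structure $(\psi_2,\psi_0)$ which together with $(\phi_2,\phi_0)$ makes it a Frobenius monoidal functor) if and only if $R$ is a Frobenius algebra in $\mathcal{C}$. Furthermore, if this is the case, then the opmonoidal structure $(\psi_2,\psi_0)$ of $\mathfrak{U}$ is uniquely determined by a Frobenius structure of $R$, in the sense that there exists a Frobenius pair $(\vartheta,e)$ for $R$ such that $\psi_0=\vartheta$ and $$\psi_{X,Y}\,q^R_{X,Y}=(\nu^R_X\otimes\mu^R_Y)(\mathrm{Id}_X\otimes e\otimes\mathrm{Id}_Y)\qquad\text{for all }X,Y\in{}_R\mathcal{C}_R .$$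
   Context: Monoidal categories are taken strict (constraints of ${}_R\mathcal{C}_R$ are suppressed below), with tensor product $\otimes$ and unit object $\underline{1}$; $m_A,\eta_A$ denote multiplication and unit of an algebra $A$. An object $X$ is coflat if $X\otimes-$ and $-\otimes X$ preserve coequalizers. For a right $R$-module $(X,\nu^R_X)$ and a left $R$-module $(Y,\mu^R_Y)$, $q^R_{X,Y}:X\otimes Y\to X\otimes_RY$ is the coequalizer of $\nu^R_X\otimes\mathrm{Id}_Y$ and $\mathrm{Id}_X\otimes\mu^R_Y$. A left $R$-module $Y$ is left robust if for all objects $M$ and right $R$-modules $X$ the morphism $\theta'_{M,X,Y}:(M\otimes X)\otimes_RY\to M\otimes(X\otimes_RY)$ with $\theta'_{M,X,Y}q^R_{M\otimes X,Y}=\mathrm{Id}_M\otimes q^R_{X,Y}$ is an isomorphism; ''every object is left robust'' means this for every algebra $R$ and every left $R$-module. Under these hypotheses the category ${}_R\mathcal{C}_R$ of $R$-bimodules in $\mathcal{C}$ is monoidal with tensor product $\otimes_R$ and unit object $R$; the associativity constraint $\Sigma'_{M,X,Y}:(M\otimes_RX)\otimes_RY\to M\otimes_R(X\otimes_RY)$ is determined by $\Sigma'_{M,X,Y}q^R_{M\otimes_RX,Y}(q^R_{M,X}\otimes\mathrm{Id}_Y)=q^R_{M,X\otimes_RY}(\mathrm{Id}_M\otimes q^R_{X,Y})$, and the unit constraints $X\otimes_RR\to X$, $R\otimes_RY\to Y$ are induced by the actions $\nu^R_X$, $\mu^R_Y$. Let $(\mathcal{A},\otimes,\underline{1})$ and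 $(\mathcal{D},\square,I)$ be monoidal categories and $\mathfrak{F}:\mathcal{A}\to\mathcal{D}$ a functor. A monoidal structure on $\mathfrak{F}$ is a natural family $\phi_{X,Y}:\mathfrak{F}(X)\square\mathfrak{F}(Y)\to\mathfrak{F}(X\otimes Y)$ and $\phi_0:I\to\mathfrak{F}(\underline{1})$ satisfying the usual associativity and unit axioms of a (lax) monoidal functor. An opmonoidal structure is a natural family $\psi_{X,Y}:\mathfrak{F}(X\otimes Y)\to\mathfrak{F}(X)\square\mathfrak{F}(Y)$ and $\psi_0:\mathfrak{F}(\underline{1})\to I$ satisfying the dual axioms: $(\psi_{X,Y}\square\mathrm{Id})\psi_{X\otimes Y,Z}=(\mathrm{Id}\square\psi_{Y,Z})\psi_{X,Y\otimes Z}$, and $(\psi_0\square\mathrm{Id})\psi_{\underline{1},X}$, $(\mathrm{Id}\square\psi_0)\psi_{X,\underline{1}}$ equal to the canonical identifications. $\mathfrak{F}$ is Frobenius monoidal if it is equipped with a monoidal structure $(\phi_2,\phi_0)$ and an opmonoidal structure $(\psi_2,\psi_0)$ such that for all $X,Y,Z$ $$(\mathrm{Id}_{\mathfrak{F}(X)}\square\phi_{Y,Z})(\psi_{X,Y}\square\mathrm{Id}_{\mathfrak{F}(Z)})=\psi_{X,Y\otimes Z}\,\phi_{X\otimes Y,Z},\qquad(\phi_{X,Y}\square\mathrm{Id}_{\mathfrak{F}(Z)})(\mathrm{Id}_{\mathfrak{F}(X)}\square\psi_{Y,Z})=\psi_{X\otimes Y,Z}\,\phi_{X,Y\otimes Z}.$$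 An algebra $R$ is Frobenius if it has a Frobenius pair $(\vartheta,e)$: morphisms $\vartheta:R\to\underline{1}$, $e:\underline{1}\to R\otimes R$ with $(m_R\otimes\mathrm{Id}_R)(\mathrm{Id}_R\otimes e)=(\mathrm{Id}_R\otimes m_R)(e\otimes\mathrm{Id}_R)$ and $(\vartheta\otimes\mathrm{Id}_R)e=\eta_R=(\mathrm{Id}_R\otimes\vartheta)e$. *)

(* Defs.v *)
From Corelib Require Import ssreflect ssrfun.
From Stdlib Require Import IndefiniteDescription ProofIrrelevance.

Reserved Notation "g ∘ f" (at level 40, left associativity).
Reserved Notation "X ⊗ Y" (at level 36, left associativity).
Reserved Notation "f ⊗₁ g" (at level 36, left associativity).

Record category := Category {
  ob :> Type;
  hom : ob -> ob -> Type;
  idm : forall X, hom X X;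
  comp : forall X Y Z, hom Y Z -> hom X Y -> hom X Z
    where "g ∘ f" := (comp _ _ _ g f);
  compA : forall X Y Z W (h : hom Z W) (g : hom Y Z) (f : hom X Y),
    h ∘ (g ∘ f) = h ∘ g ∘ f;
  compfi : forall X Y (f : hom X Y), f ∘ idm X = f;
  compif : forall X Y (f : hom X Y), idm Y ∘ f = f }.

Arguments hom {c} X Y.
Arguments idm {c} X.
Arguments comp {c X Y Z} g f.
Arguments compA {c X Y Z W} h g f.
Arguments compfi {c X Y} f.
Arguments compif {c X Y} f.

Notation "g ∘ f" := (comp g f).

Definition is_iso {C : category} {X Y : C} (f : hom X Y) : Prop :=
  exists g : hom Y X, g ∘ f = idm X /\ f ∘ g = idm Y.

Record functor (C D : category) := Functor {
  fob :> C -> D;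
  fmap : forall X Y, hom X Y -> hom (fob X) (fob Y);
  fmap_id : forall X, fmap X X (idm X) = idm (fob X);
  fmap_comp : forall X Y Z (g : hom Y Z) (f : hom X Y),
    fmap X Z (g ∘ f) = fmap Y Z g ∘ fmap X Y f }.

Arguments fob {C D} F X : rename.
Arguments fmap {C D} F {X Y} f : rename.
Arguments fmap_id {C D} F X : rename.
Arguments fmap_comp {C D} F {X Y Z} g f : rename.

Definition is_coequalizer {C : category} {X Y Q : C}
    (f g : hom X Y) (q : hom Y Q) : Prop :=
  q ∘ f = q ∘ g /\
  forall (Z : C) (h : hom Y Z), h ∘ f = h ∘ g -> exists! k : hom Q Z, k ∘ q = h.

(* A choice of coequalizers is part of the data; [X ⊗_R Y] is the chosen one. *)
Record has_coequalizers (C : category) := HasCoequalizers {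
  coeq : forall X Y : C, hom X Y -> hom X Y -> C;
  coeq_map : forall (X Y : C) (f g : hom X Y), hom Y (coeq X Y f g);
  coeq_mapP : forall (X Y : C) (f g : hom X Y), is_coequalizer f g (coeq_map X Y f g) }.

Arguments coeq {C} h {X Y} f g.
Arguments coeq_map {C} h {X Y} f g.
Arguments coeq_mapP {C} h {X Y} f g.

Section CategoryFacts.
Context {C : category}.

(* [post2] and [post3] rewrite an inner factor of a left-associated composite. *)
Lemma post2 {X Y Z : C} {a : hom Y Z} {b : hom X Y} {c : hom X Z} :
  a ∘ b = c -> forall (W : C) (x : hom Z W), x ∘ a ∘ b = x ∘ c.
Proof. by move=> <- W x; rewrite compA. Qed.

Lemma post3 {X Y Y' Z : C} {a : hom Y Z} {b : hom Y' Y} {b' : hom X Y'} {c : hom X Z} :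
  a ∘ b ∘ b' = c -> forall (W : C) (x : hom Z W), x ∘ a ∘ b ∘ b' = x ∘ c.
Proof. by move=> <- W x; rewrite ?compA. Qed.

Definition is_epi {X Y : C} (f : hom X Y) : Prop :=
  forall (Z : C) (g h : hom Y Z), g ∘ f = h ∘ f -> g = h.

Lemma epi_comp {X Y Z : C} {g : hom Y Z} {f : hom X Y} :
  is_epi g -> is_epi f -> is_epi (g ∘ f).
Proof. by move=> eg ef W a b; rewrite ?compA => /ef /eg. Qed.

Lemma iso_epi {X Y : C} (f : hom X Y) : is_iso f -> is_epi f.
Proof.
move=> [g [_ fg]] Z a b e.
by rewrite -(compfi a) -(compfi b) -fg ?compA e.
Qed.

Lemma coequalizer_epi {X Y Q : C} {f g : hom X Y} {q : hom Y Q} :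
  is_coequalizer f g q -> is_epi q.
Proof.
move=> [e u] Z a b eab.
have eb : (b ∘ q) ∘ f = (b ∘ q) ∘ g by rewrite -?compA e.
have [k [_ uk]] := u _ _ eb.
by rewrite -(uk a eab) -(uk b erefl).
Qed.

Definition coeq_desc {X Y Q : C} {f g : hom X Y} {q : hom Y Q}
    (cq : is_coequalizer f g q) {Z : C} {h : hom Y Z} (e : h ∘ f = h ∘ g) : hom Q Z :=
  proj1_sig (constructive_indefinite_description _ (proj2 cq Z h e)).

Lemma coeq_descK {X Y Q : C} {f g : hom X Y} {q : hom Y Q}
    (cq : is_coequalizer f g q) {Z : C} {h : hom Y Z} (e : h ∘ f = h ∘ g) :
  coeq_desc cq e ∘ q = h.
Proof. by rewrite /coeq_desc; case: constructive_indefinite_description => k []. Qed.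

End CategoryFacts.

(* Constraints are explicit data, so that bimodules over an algebra form an
   instance.  The strict case is the one in which the constraints are the
   identities along the equalities of objects. *)

Record monoidal_category := MonoidalCategory {
  mcat :> category;
  tens : mcat -> mcat -> mcat
    where "X ⊗ Y" := (tens X Y);
  tensm : forall X X' Y Y' : mcat, hom X X' -> hom Y Y' -> hom (X ⊗ Y) (X' ⊗ Y')
    where "f ⊗₁ g" := (tensm _ _ _ _ f g);
  munit : mcat;
  tens_id : forall X Y : mcat, idm X ⊗₁ idm Y = idm (X ⊗ Y);
  tens_comp : forall (X X' X'' Y Y' Y'' : mcat)
      (f' : hom X' X'') (f : hom X X') (g' : hom Y' Y'') (g : hom Y Y'),
    (f' ∘ f) ⊗₁ (g' ∘ g) = (f' ⊗₁ g') ∘ (f ⊗₁ g);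
  assoc : forall X Y Z : mcat, hom ((X ⊗ Y) ⊗ Z) (X ⊗ (Y ⊗ Z));
  assoc_inv : forall X Y Z : mcat, hom (X ⊗ (Y ⊗ Z)) ((X ⊗ Y) ⊗ Z);
  assocK : forall X Y Z, assoc_inv X Y Z ∘ assoc X Y Z = idm _;
  assocVK : forall X Y Z, assoc X Y Z ∘ assoc_inv X Y Z = idm _;
  assoc_nat : forall (X X' Y Y' Z Z' : mcat)
      (f : hom X X') (g : hom Y Y') (h : hom Z Z'),
    assoc X' Y' Z' ∘ ((f ⊗₁ g) ⊗₁ h) = (f ⊗₁ (g ⊗₁ h)) ∘ assoc X Y Z;
  lunit : forall X, hom (munit ⊗ X) X;
  lunit_inv : forall X, hom X (munit ⊗ X);
  lunitK : forall X, lunit_inv X ∘ lunit X = idm _;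
  lunitVK : forall X, lunit X ∘ lunit_inv X = idm _;
  lunit_nat : forall (X Y : mcat) (f : hom X Y),
    lunit Y ∘ (idm munit ⊗₁ f) = f ∘ lunit X;
  runit : forall X, hom (X ⊗ munit) X;
  runit_inv : forall X, hom X (X ⊗ munit);
  runitK : forall X, runit_inv X ∘ runit X = idm _;
  runitVK : forall X, runit X ∘ runit_inv X = idm _;
  runit_nat : forall (X Y : mcat) (f : hom X Y),
    runit Y ∘ (f ⊗₁ idm munit) = f ∘ runit X;
  pentagon : forall W X Y Z : mcat,
    assoc W X (Y ⊗ Z) ∘ assoc (W ⊗ X) Y Z =
    (idm W ⊗₁ assoc X Y Z) ∘ assoc W (X ⊗ Y) Z ∘ (assoc W X Y ⊗₁ idm Z);
  triangle : forall X Y : mcat,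
    (idm X ⊗₁ lunit Y) ∘ assoc X munit Y = runit X ⊗₁ idm Y }.

Arguments tens {m} X Y.
Arguments tensm {m X X' Y Y'} f g.
Arguments munit {m}.
Arguments assoc {m} X Y Z.
Arguments assoc_inv {m} X Y Z.
Arguments lunit {m} X.
Arguments lunit_inv {m} X.
Arguments runit {m} X.
Arguments runit_inv {m} X.
Arguments tens_comp {m X X' X'' Y Y' Y''} f' f g' g.
Arguments assoc_nat {m X X' Y Y' Z Z'} f g h.
Arguments lunit_nat {m X Y} f.
Arguments runit_nat {m X Y} f.
Arguments tens_id {m} X Y.
Arguments assocK {m} X Y Z.
Arguments assocVK {m} X Y Z.
Arguments lunitK {m} X.
Arguments lunitVK {m} X.
Arguments runitK {m} X.
Arguments runitVK {m} X.
Arguments pentagon {m} W X Y Z.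
Arguments triangle {m} X Y.

Notation "X ⊗ Y" := (tens X Y).
Notation "f ⊗₁ g" := (tensm f g).
Notation "𝟏" := munit.

Section MonoidalFacts.
Context {C : monoidal_category}.
Implicit Types X Y Z W : C.

Lemma tens_compl {X X' X'' Y} (f : hom X' X'') (g : hom X X') :
  (f ∘ g) ⊗₁ idm Y = (f ⊗₁ idm Y) ∘ (g ⊗₁ idm Y).
Proof. by rewrite -tens_comp compfi. Qed.

Lemma tens_compr {X X' X'' Y} (f : hom X' X'') (g : hom X X') :
  idm Y ⊗₁ (f ∘ g) = (idm Y ⊗₁ f) ∘ (idm Y ⊗₁ g).
Proof. by rewrite -tens_comp compfi. Qed.

Lemma tens_swap {X X' Y Y'} (f : hom X X') (g : hom Y Y') :
  (f ⊗₁ idm Y') ∘ (idm X ⊗₁ g) = (idm X' ⊗₁ g) ∘ (f ⊗₁ idm Y).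
Proof. by rewrite -!tens_comp !compfi !compif. Qed.

Lemma tens_lr {X X' Y Y'} (f : hom X X') (g : hom Y Y') :
  (f ⊗₁ idm Y') ∘ (idm X ⊗₁ g) = f ⊗₁ g.
Proof. by rewrite -!tens_comp !compfi !compif. Qed.

Lemma tens_rl {X X' Y Y'} (f : hom X X') (g : hom Y Y') :
  (idm X' ⊗₁ g) ∘ (f ⊗₁ idm Y) = f ⊗₁ g.
Proof. by rewrite -!tens_comp !compfi !compif. Qed.

Lemma assoc_epi X Y Z : is_epi (assoc X Y Z).
Proof. by apply: iso_epi; exists (assoc_inv X Y Z); rewrite assocK assocVK. Qed.

Lemma assoc_inv_epi X Y Z : is_epi (assoc_inv X Y Z).
Proof. by apply: iso_epi; exists (assoc X Y Z); rewrite assocK assocVK. Qed.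

Lemma assoc_inv_nat {X X' Y Y' Z Z'} (f : hom X X') (g : hom Y Y') (h : hom Z Z') :
  assoc_inv X' Y' Z' ∘ (f ⊗₁ (g ⊗₁ h)) = ((f ⊗₁ g) ⊗₁ h) ∘ assoc_inv X Y Z.
Proof.
by apply: assoc_epi; rewrite -?compA assocK compfi -assoc_nat compA assocK compif.
Qed.

Lemma tens1_inj {X Y} (f g : hom X Y) : idm 𝟏 ⊗₁ f = idm 𝟏 ⊗₁ g -> f = g.
Proof.
move=> e; rewrite -(compfi f) -(compfi g) -(lunitVK X) ?compA.
by rewrite -!lunit_nat e.
Qed.

Lemma tens1r_inj {X Y} (f g : hom X Y) : f ⊗₁ idm 𝟏 = g ⊗₁ idm 𝟏 -> f = g.
Proof.
move=> e; rewrite -(compfi f) -(compfi g) -(runitVK X) ?compA.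
by rewrite -!runit_nat e.
Qed.

Lemma lunit_inv_nat {X Y} (f : hom X Y) :
  lunit_inv Y ∘ f = (idm 𝟏 ⊗₁ f) ∘ lunit_inv X.
Proof.
rewrite -[RHS]compif -(lunitK Y) -compA (compA (lunit Y)) lunit_nat.
by rewrite -(compA f) lunitVK compfi.
Qed.

Lemma runit_inv_nat {X Y} (f : hom X Y) :
  runit_inv Y ∘ f = (f ⊗₁ idm 𝟏) ∘ runit_inv X.
Proof.
rewrite -[RHS]compif -(runitK Y) -compA (compA (runit Y)) runit_nat.
by rewrite -(compA f) runitVK compfi.
Qed.

Lemma assoc_tens_epi W X Y Z : is_epi (assoc W X Y ⊗₁ idm Z).
Proof.
apply: iso_epi; exists (assoc_inv W X Y ⊗₁ idm Z).
by rewrite -!tens_compl assocK assocVK !tens_id.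
Qed.

Lemma lunit_tens X Y : lunit (X ⊗ Y) ∘ assoc 𝟏 X Y = lunit X ⊗₁ idm Y.
Proof.
apply: tens1_inj; apply: (epi_comp (assoc_epi 𝟏 (𝟏 ⊗ X) Y) (assoc_tens_epi 𝟏 𝟏 X Y)).
rewrite tens_compr ?compA (post3 (esym (pentagon _ _ _ _))).
by rewrite ?compA triangle -(tens_id X Y) -assoc_nat -triangle tens_compl compA assoc_nat.
Qed.

Lemma runit_tens X Y : (idm X ⊗₁ runit Y) ∘ assoc X Y 𝟏 = runit (X ⊗ Y).
Proof.
apply: tens1r_inj.
rewrite -[LHS]compif -[RHS]compif -(assocK X Y 𝟏) -?compA; congr (_ ∘ _).
rewrite tens_compl compA assoc_nat -(triangle Y 𝟏) tens_compr.
rewrite -(triangle (X ⊗ Y) 𝟏) (post3 (esym (pentagon _ _ _ _))) ?compA.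
by rewrite -(tens_id X Y) assoc_nat.
Qed.

Lemma pentagon_inv W X Y Z :
  assoc_inv (W ⊗ X) Y Z ∘ assoc_inv W X (Y ⊗ Z) =
  (assoc_inv W X Y ⊗₁ idm Z) ∘ assoc_inv W (X ⊗ Y) Z ∘ (idm W ⊗₁ assoc_inv X Y Z).
Proof.
apply: (epi_comp (assoc_epi W X (Y ⊗ Z)) (assoc_epi (W ⊗ X) Y Z)).
rewrite {2}pentagon ?compA (post2 (assocK _ _ _)) compfi assocK.
rewrite (post2 (esym (tens_compr _ _))) assocK tens_id compfi.
by rewrite (post2 (assocK _ _ _)) compfi -tens_compl assocK tens_id.
Qed.

Lemma pentagon_mixed W X Y Z :
  assoc (W ⊗ X) Y Z ∘ (assoc_inv W X Y ⊗₁ idm Z) ∘ assoc_inv W (X ⊗ Y) Z =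
  assoc_inv W X (Y ⊗ Z) ∘ (idm W ⊗₁ assoc X Y Z).
Proof.
apply: (epi_comp (assoc_epi W (X ⊗ Y) Z) (assoc_tens_epi W X Y Z)).
rewrite ?compA (post2 (assocK _ _ _)) compfi -(compA _ _ (assoc W X Y ⊗₁ idm Z)).
rewrite -tens_compl assocK tens_id compfi -[LHS]compif -(assocK W X (Y ⊗ Z)).
by rewrite -compA pentagon ?compA.
Qed.

Lemma pentagon_mixed2 W X Y Z :
  assoc_inv W (X ⊗ Y) Z ∘ (idm W ⊗₁ assoc_inv X Y Z) ∘ assoc W X (Y ⊗ Z) =
  (assoc W X Y ⊗₁ idm Z) ∘ assoc_inv (W ⊗ X) Y Z.
Proof.
apply: (assoc_inv_epi W X (Y ⊗ Z)).
rewrite -[LHS]compA assocVK compfi -[RHS]compA pentagon_inv ?compA -tens_compl.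
by rewrite assocVK tens_id compif.
Qed.

End MonoidalFacts.

Definition coflat {C : monoidal_category} (X : C) : Prop :=
  forall (Y Z Q : C) (f g : hom Y Z) (q : hom Z Q), is_coequalizer f g q ->
    is_coequalizer (idm X ⊗₁ f) (idm X ⊗₁ g) (idm X ⊗₁ q) /\
    is_coequalizer (f ⊗₁ idm X) (g ⊗₁ idm X) (q ⊗₁ idm X).

Record algebra (C : monoidal_category) := Algebra {
  alg_ob :> C;
  amul : hom (alg_ob ⊗ alg_ob) alg_ob;
  aunit : hom 𝟏 alg_ob;
  amulA : amul ∘ (amul ⊗₁ idm alg_ob) =
    amul ∘ (idm alg_ob ⊗₁ amul) ∘ assoc alg_ob alg_ob alg_ob;
  amul1l : amul ∘ (aunit ⊗₁ idm alg_ob) = lunit alg_ob;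
  amul1r : amul ∘ (idm alg_ob ⊗₁ aunit) = runit alg_ob }.

Arguments alg_ob {C} R : rename.
Arguments amul {C} R : rename.
Arguments aunit {C} R : rename.
Arguments amulA {C} R : rename.
Arguments amul1l {C} R : rename.
Arguments amul1r {C} R : rename.

Record left_module {C : monoidal_category} (R : algebra C) := LeftModule {
  lmod_ob :> C;
  lact : hom (R ⊗ lmod_ob) lmod_ob;
  lactA : lact ∘ (amul R ⊗₁ idm lmod_ob) =
    lact ∘ (idm R ⊗₁ lact) ∘ assoc R R lmod_ob;
  lact1 : lact ∘ (aunit R ⊗₁ idm lmod_ob) = lunit lmod_ob }.

Arguments lmod_ob {C R} X : rename.
Arguments lact {C R} X : rename.
Arguments lactA {C R} X : rename.
Arguments lact1 {C R} X : rename.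
Arguments LeftModule {C R} lmod_ob lact lactA lact1.

Record right_module {C : monoidal_category} (R : algebra C) := RightModule {
  rmod_ob :> C;
  ract : hom (rmod_ob ⊗ R) rmod_ob;
  ractA : ract ∘ (ract ⊗₁ idm R) =
    ract ∘ (idm rmod_ob ⊗₁ amul R) ∘ assoc rmod_ob R R;
  ract1 : ract ∘ (idm rmod_ob ⊗₁ aunit R) = runit rmod_ob }.

Arguments rmod_ob {C R} X : rename.
Arguments ract {C R} X : rename.
Arguments ractA {C R} X : rename.
Arguments ract1 {C R} X : rename.
Arguments RightModule {C R} rmod_ob ract ractA ract1.

Record bimodule {C : monoidal_category} (R : algebra C) := Bimodule {
  bim_ob : C;
  bim_lact : hom (R ⊗ bim_ob) bim_ob;
  bim_lactA : bim_lact ∘ (amul R ⊗₁ idm bim_ob) =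
    bim_lact ∘ (idm R ⊗₁ bim_lact) ∘ assoc R R bim_ob;
  bim_lact1 : bim_lact ∘ (aunit R ⊗₁ idm bim_ob) = lunit bim_ob;
  bim_ract : hom (bim_ob ⊗ R) bim_ob;
  bim_ractA : bim_ract ∘ (bim_ract ⊗₁ idm R) =
    bim_ract ∘ (idm bim_ob ⊗₁ amul R) ∘ assoc bim_ob R R;
  bim_ract1 : bim_ract ∘ (idm bim_ob ⊗₁ aunit R) = runit bim_ob;
  bim_compat : bim_ract ∘ (bim_lact ⊗₁ idm R) =
    bim_lact ∘ (idm R ⊗₁ bim_ract) ∘ assoc R bim_ob R }.

Arguments bim_ob {C R} X : rename.
Arguments bim_lact {C R} X : rename.
Arguments bim_lactA {C R} X : rename.
Arguments bim_lact1 {C R} X : rename.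
Arguments bim_ract {C R} X : rename.
Arguments bim_ractA {C R} X : rename.
Arguments bim_ract1 {C R} X : rename.
Arguments bim_compat {C R} X : rename.
Arguments Bimodule {C R}.

Definition bim_left {C : monoidal_category} {R : algebra C} (X : bimodule R) :
  left_module R := LeftModule (bim_ob X) (bim_lact X) (bim_lactA X) (bim_lact1 X).

Definition bim_right {C : monoidal_category} {R : algebra C} (X : bimodule R) :
  right_module R := RightModule (bim_ob X) (bim_ract X) (bim_ractA X) (bim_ract1 X).

Coercion bim_ob : bimodule >-> ob.
Coercion bim_left : bimodule >-> left_module.
Coercion bim_right : bimodule >-> right_module.

Section TensRightModule.
Context {C : monoidal_category} {R : algebra C} (M : C) (X : right_module R).

Lemma tens_ractA :
  ((idm M ⊗₁ ract X) ∘ assoc M X R) ∘ (((idm M ⊗₁ ract X) ∘ assoc M X R) ⊗₁ idm R) =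
  ((idm M ⊗₁ ract X) ∘ assoc M X R) ∘ (idm (M ⊗ X) ⊗₁ amul R) ∘ assoc (M ⊗ X) R R.
Proof.
rewrite tens_compl ?compA (post2 (assoc_nat _ _ _)) ?compA -tens_compr ractA.
rewrite !tens_compr ?compA (post3 (esym (pentagon _ _ _ _))) ?compA.
by rewrite -(tens_id M X) (post2 (assoc_nat _ _ _)) ?compA.
Qed.

Lemma tens_ract1 :
  ((idm M ⊗₁ ract X) ∘ assoc M X R) ∘ (idm (M ⊗ X) ⊗₁ aunit R) = runit (M ⊗ X).
Proof.
by rewrite -tens_id -compA assoc_nat compA -tens_compr ract1 runit_tens.
Qed.

Definition tens_right_module : right_module R :=
  RightModule (M ⊗ X) ((idm M ⊗₁ ract X) ∘ assoc M X R) tens_ractA tens_ract1.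

End TensRightModule.

Section TensorOver.
Context {C : monoidal_category} (Co : has_coequalizers C) {R : algebra C}.
Implicit Types (M : C) (X : right_module R) (Y : left_module R).

Definition tens_over (X : right_module R) (Y : left_module R) : C :=
  coeq Co (ract X ⊗₁ idm Y) ((idm X ⊗₁ lact Y) ∘ assoc X R Y).

Definition qmap (X : right_module R) (Y : left_module R) : hom (X ⊗ Y) (tens_over X Y) :=
  coeq_map Co (ract X ⊗₁ idm Y) ((idm X ⊗₁ lact Y) ∘ assoc X R Y).

Lemma qmap_coequalizer X Y :
  is_coequalizer (ract X ⊗₁ idm Y) ((idm X ⊗₁ lact Y) ∘ assoc X R Y) (qmap X Y).
Proof. exact: coeq_mapP. Qed.

Lemma qmap_epi X Y : is_epi (qmap X Y).
Proof. exact: coequalizer_epi (qmap_coequalizer X Y). Qed.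

Lemma qmapE X Y :
  qmap X Y ∘ (ract X ⊗₁ idm Y) = qmap X Y ∘ (idm X ⊗₁ lact Y) ∘ assoc X R Y.
Proof. by rewrite (proj1 (qmap_coequalizer X Y)) compA. Qed.

Lemma theta_map_subproof (M : C) (X : right_module R) (Y : left_module R) :
  ((idm M ⊗₁ qmap X Y) ∘ assoc M X Y) ∘ (ract (tens_right_module M X) ⊗₁ idm Y) =
  ((idm M ⊗₁ qmap X Y) ∘ assoc M X Y) ∘
    ((idm (M ⊗ X) ⊗₁ lact Y) ∘ assoc (M ⊗ X) R Y).
Proof.
rewrite /= tens_compl ?compA (post2 (assoc_nat _ _ _)) ?compA -tens_compr qmapE.
rewrite -(tens_id M X) (post2 (assoc_nat _ _ _)) ?compA.
by rewrite (post2 (pentagon _ _ _ _)) !tens_compr ?compA.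
Qed.

Definition theta_map (M : C) (X : right_module R) (Y : left_module R) :
    hom (tens_over (tens_right_module M X) Y) (M ⊗ tens_over X Y) :=
  coeq_desc (qmap_coequalizer (tens_right_module M X) Y) (theta_map_subproof M X Y).

Lemma theta_mapE M X Y :
  theta_map M X Y ∘ qmap (tens_right_module M X) Y = (idm M ⊗₁ qmap X Y) ∘ assoc M X Y.
Proof. exact: coeq_descK. Qed.

Definition left_robust (Y : left_module R) : Prop :=
  forall (M : C) (X : right_module R), is_iso (theta_map M X Y).

End TensorOver.

Section BimoduleCategory.
Context {C : monoidal_category} (R : algebra C).

Definition is_bimodule_map {X Y : bimodule R} (f : hom X Y) : Prop :=
  f ∘ bim_lact X = bim_lact Y ∘ (idm R ⊗₁ f) /\
  f ∘ bim_ract X = bim_ract Y ∘ (f ⊗₁ idm R).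

Record bimodule_hom (X Y : bimodule R) := BimoduleHom {
  bmap : hom X Y;
  bmapP : is_bimodule_map bmap }.

Arguments BimoduleHom {X Y} bmap bmapP.
Arguments bmap {X Y} f : rename.
Arguments bmapP {X Y} f : rename.

Lemma bimodule_hom_eq {X Y} (f g : bimodule_hom X Y) : bmap f = bmap g -> f = g.
Proof.
case: f g => [f Pf] [g Pg] /= e; case: _ / e in Pg *.
by congr BimoduleHom; apply: proof_irrelevance.
Qed.

Lemma bimodule_idP X : is_bimodule_map (idm (bim_ob X)).
Proof. by split; rewrite !tens_id compfi compif. Qed.

Lemma bimodule_compP {X Y Z : bimodule R} (g : hom Y Z) (f : hom X Y) :
  is_bimodule_map g -> is_bimodule_map f -> is_bimodule_map (g ∘ f).
Proof.
move=> [gl gr] [fl fr]; split.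
- by rewrite -compA fl compA gl -compA tens_compr.
- by rewrite -compA fr compA gr -compA tens_compl.
Qed.

Lemma bimodule_invP {X Y : bimodule R} (f : hom X Y) (g : hom Y X) :
  is_bimodule_map f -> g ∘ f = idm (bim_ob X) -> f ∘ g = idm (bim_ob Y) ->
  is_bimodule_map g.
Proof.
move=> [fl fr] gf fg; split.
- rewrite -[RHS]compif -gf -compA (compA f) fl -compA -tens_compr fg tens_id.
  by rewrite compfi.
- rewrite -[RHS]compif -gf -compA (compA f) fr -compA -tens_compl fg tens_id.
  by rewrite compfi.
Qed.

Definition bimodule_id X : bimodule_hom X X :=
  BimoduleHom (idm (bim_ob X)) (bimodule_idP X).

Definition bimodule_comp X Y Z (g : bimodule_hom Y Z) (f : bimodule_hom X Y) :
    bimodule_hom X Z :=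
  BimoduleHom (bmap g ∘ bmap f) (bimodule_compP _ _ (bmapP g) (bmapP f)).

Definition bimodule_category : category.
Proof.
refine (@Category (bimodule R) bimodule_hom bimodule_id bimodule_comp _ _ _).
- by move=> *; apply: bimodule_hom_eq; apply: compA.
- by move=> *; apply: bimodule_hom_eq; apply: compfi.
- by move=> *; apply: bimodule_hom_eq; apply: compif.
Defined.

End BimoduleCategory.

Arguments bmap {C R X Y} f : rename.
Arguments BimoduleHom {C R X Y} & bmap bmapP.
Arguments bmapP {C R X Y} f : rename.
Arguments bimodule_hom {C R} X Y.

Section BimoduleTensor.
Context {C : monoidal_category} (Co : has_coequalizers C).
Context (coflatC : forall X : C, coflat X) {R : algebra C}.
Implicit Types W X Y Z : bimodule R.

(* [bq] is [qmap] with the carriers written through [bim_ob], for rewriting. *)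
Definition bq X Y : hom (bim_ob X ⊗ bim_ob Y) (tens_over Co X Y) := qmap Co X Y.

Lemma bq_coeq X Y :
  is_coequalizer (bim_ract X ⊗₁ idm (bim_ob Y))
    ((idm (bim_ob X) ⊗₁ bim_lact Y) ∘ assoc (bim_ob X) R (bim_ob Y)) (bq X Y).
Proof. exact: (qmap_coequalizer Co X Y). Qed.

Lemma bq_coeql (M : C) X Y :
  is_coequalizer (idm M ⊗₁ (bim_ract X ⊗₁ idm (bim_ob Y)))
    (idm M ⊗₁ ((idm (bim_ob X) ⊗₁ bim_lact Y) ∘ assoc (bim_ob X) R (bim_ob Y)))
    (idm M ⊗₁ bq X Y).
Proof. exact: (proj1 (coflatC M _ _ _ _ _ _ (bq_coeq X Y))). Qed.

Lemma bq_coeqr (M : C) X Y :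
  is_coequalizer ((bim_ract X ⊗₁ idm (bim_ob Y)) ⊗₁ idm M)
    (((idm (bim_ob X) ⊗₁ bim_lact Y) ∘ assoc (bim_ob X) R (bim_ob Y)) ⊗₁ idm M)
    (bq X Y ⊗₁ idm M).
Proof. exact: (proj2 (coflatC M _ _ _ _ _ _ (bq_coeq X Y))). Qed.

Lemma bq_epi X Y : is_epi (bq X Y).
Proof. exact: coequalizer_epi (bq_coeq X Y). Qed.

Lemma bq_epil (M : C) X Y : is_epi (idm M ⊗₁ bq X Y).
Proof. exact: coequalizer_epi (bq_coeql M X Y). Qed.

Lemma bq_epir (M : C) X Y : is_epi (bq X Y ⊗₁ idm M).
Proof. exact: coequalizer_epi (bq_coeqr M X Y). Qed.

Lemma bqE X Y :
  bq X Y ∘ (bim_ract X ⊗₁ idm (bim_ob Y)) =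
  bq X Y ∘ (idm (bim_ob X) ⊗₁ bim_lact Y) ∘ assoc (bim_ob X) R (bim_ob Y).
Proof. exact: (qmapE Co X Y). Qed.

Lemma coeq_epil (M : C) {W X Y : C} {g h : hom W X} {f : hom X Y} :
  is_coequalizer g h f -> is_epi (idm M ⊗₁ f).
Proof. by move=> c; exact: coequalizer_epi (proj1 (coflatC M _ _ _ _ _ _ c)). Qed.

Lemma coeq_epir (M : C) {W X Y : C} {g h : hom W X} {f : hom X Y} :
  is_coequalizer g h f -> is_epi (f ⊗₁ idm M).
Proof. by move=> c; exact: coequalizer_epi (proj2 (coflatC M _ _ _ _ _ _ c)). Qed.

Lemma bq_epill (M N : C) X Y : is_epi (idm N ⊗₁ (idm M ⊗₁ bq X Y)).
Proof. exact: coeq_epil (bq_coeql M X Y). Qed.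

Lemma bq_epilr (M N : C) X Y : is_epi ((idm M ⊗₁ bq X Y) ⊗₁ idm N).
Proof. exact: coeq_epir (bq_coeql M X Y). Qed.

Lemma bq_epirl (M N : C) X Y : is_epi (idm N ⊗₁ (bq X Y ⊗₁ idm M)).
Proof. exact: coeq_epil (bq_coeqr M X Y). Qed.

Lemma bq_epirr (M N : C) X Y : is_epi ((bq X Y ⊗₁ idm M) ⊗₁ idm N).
Proof. exact: coeq_epir (bq_coeqr M X Y). Qed.

(* [R ⊗ -] and [- ⊗ R] preserve the coequalizer [bq X Y], hence the actions of
   the outer factors descend to [X ⊗_R Y]. *)
Lemma bt_lact_subproof X Y :
  let h := bq X Y ∘ (bim_lact X ⊗₁ idm (bim_ob Y)) ∘
    assoc_inv R (bim_ob X) (bim_ob Y) in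
  h ∘ (idm R ⊗₁ (bim_ract X ⊗₁ idm (bim_ob Y))) =
  h ∘ (idm R ⊗₁ ((idm (bim_ob X) ⊗₁ bim_lact Y) ∘ assoc (bim_ob X) R (bim_ob Y))).
Proof.
rewrite /= tens_compr ?compA !(post2 (assoc_inv_nat _ _ _)) ?compA.
rewrite tens_id (post2 (tens_swap _ _)) ?compA.
rewrite (post2 (esym (pentagon_mixed _ _ _ _))) ?compA.
rewrite -(compA (bq X Y) _ (_ ⊗₁ idm (bim_ob Y))) -tens_compl.
have -> : bim_lact X ∘ (idm R ⊗₁ bim_ract X) =
    bim_ract X ∘ (bim_lact X ⊗₁ idm R) ∘ assoc_inv R X R.
  by rewrite bim_compat -[RHS]compA assocVK compfi.
rewrite !tens_compl ?compA bqE (post2 (assoc_nat _ _ _)) ?compA.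
by rewrite tens_id.
Qed.

Definition bt_lact X Y : hom (R ⊗ tens_over Co X Y) (tens_over Co X Y) :=
  coeq_desc (bq_coeql R X Y) (bt_lact_subproof X Y).

Lemma bt_lactE X Y :
  bt_lact X Y ∘ (idm R ⊗₁ bq X Y) =
  bq X Y ∘ (bim_lact X ⊗₁ idm (bim_ob Y)) ∘ assoc_inv R (bim_ob X) (bim_ob Y).
Proof. exact: coeq_descK. Qed.

Lemma bt_ract_subproof X Y :
  let h := bq X Y ∘ (idm (bim_ob X) ⊗₁ bim_ract Y) ∘
    assoc (bim_ob X) (bim_ob Y) R in
  h ∘ ((bim_ract X ⊗₁ idm (bim_ob Y)) ⊗₁ idm R) =
  h ∘ (((idm (bim_ob X) ⊗₁ bim_lact Y) ∘ assoc (bim_ob X) R (bim_ob Y)) ⊗₁ idm R).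
Proof.
rewrite /= tens_compl ?compA !(post2 (assoc_nat _ _ _)) ?compA.
rewrite tens_id (post2 (esym (tens_swap _ _))) ?compA bqE.
rewrite -(tens_id (bim_ob X) R) (post2 (assoc_nat _ _ _)) ?compA.
rewrite (post2 (pentagon _ _ _ _)) ?compA.
rewrite -!(compA (bq X Y) (_ ⊗₁ _)) -!tens_compr.
by rewrite bim_compat !tens_compr ?compA.
Qed.

Definition bt_ract X Y : hom (tens_over Co X Y ⊗ R) (tens_over Co X Y) :=
  coeq_desc (bq_coeqr R X Y) (bt_ract_subproof X Y).

Lemma bt_ractE X Y :
  bt_ract X Y ∘ (bq X Y ⊗₁ idm R) =
  bq X Y ∘ (idm (bim_ob X) ⊗₁ bim_ract Y) ∘ assoc (bim_ob X) (bim_ob Y) R.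
Proof. exact: coeq_descK. Qed.

Lemma bt_lactA X Y :
  bt_lact X Y ∘ (amul R ⊗₁ idm (tens_over Co X Y)) =
  bt_lact X Y ∘ (idm R ⊗₁ bt_lact X Y) ∘ assoc R R (tens_over Co X Y).
Proof.
apply: (bq_epil (R ⊗ R) X Y).
rewrite -[LHS]compA tens_swap ?compA bt_lactE -(tens_id (bim_ob X) (bim_ob Y)).
rewrite (post2 (assoc_inv_nat _ _ _)) ?compA -(compA _ (bim_lact X ⊗₁ _)) -tens_compl.
rewrite bim_lactA -(tens_id R R) -[RHS]compA assoc_nat ?compA.
rewrite -(compA _ _ (idm R ⊗₁ (idm R ⊗₁ bq X Y))) -tens_compr bt_lactE.
rewrite !tens_compr ?compA bt_lactE (post2 (assoc_inv_nat _ _ _)) ?compA.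
by rewrite (post3 (pentagon_mixed2 _ _ _ _)) !tens_compl ?compA.
Qed.

Lemma bt_lact1 X Y :
  bt_lact X Y ∘ (aunit R ⊗₁ idm (tens_over Co X Y)) = lunit (tens_over Co X Y).
Proof.
apply: (bq_epil 𝟏 X Y); rewrite lunit_nat.
rewrite -[LHS]compA tens_swap ?compA bt_lactE -(tens_id (bim_ob X) (bim_ob Y)).
rewrite (post2 (assoc_inv_nat _ _ _)) ?compA -(compA _ (bim_lact X ⊗₁ _)) -tens_compl.
by rewrite bim_lact1 -lunit_tens -!compA assocVK compfi.
Qed.

Lemma bt_ractA X Y :
  bt_ract X Y ∘ (bt_ract X Y ⊗₁ idm R) =
  bt_ract X Y ∘ (idm (tens_over Co X Y) ⊗₁ amul R) ∘ assoc (tens_over Co X Y) R R.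
Proof.
apply: (bq_epirr R R X Y).
rewrite -[LHS]compA -tens_compl bt_ractE !tens_compl ?compA bt_ractE.
rewrite (post2 (assoc_nat _ _ _)) ?compA -(compA _ _ (idm X ⊗₁ (_ ⊗₁ _))) -tens_compr.
rewrite bim_ractA -[RHS]compA assoc_nat tens_id ?compA.
rewrite -(compA (bt_ract X Y)) -tens_swap ?compA bt_ractE.
rewrite -(tens_id (bim_ob X)) (post2 (assoc_nat _ _ _)) ?compA.
by rewrite (post2 (pentagon _ _ _ _)) !tens_compr ?compA.
Qed.

Lemma bt_ract1 X Y :
  bt_ract X Y ∘ (idm (tens_over Co X Y) ⊗₁ aunit R) = runit (tens_over Co X Y).
Proof.
apply: (bq_epir 𝟏 X Y); rewrite runit_nat.
rewrite -[LHS]compA -tens_swap ?compA bt_ractE -(tens_id (bim_ob X) (bim_ob Y)).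
rewrite (post2 (assoc_nat _ _ _)) ?compA -(compA _ _ (idm X ⊗₁ (_ ⊗₁ _))) -tens_compr.
by rewrite bim_ract1 -compA runit_tens.
Qed.

Lemma bt_compat X Y :
  bt_ract X Y ∘ (bt_lact X Y ⊗₁ idm R) =
  bt_lact X Y ∘ (idm R ⊗₁ bt_ract X Y) ∘ assoc R (tens_over Co X Y) R.
Proof.
apply: (bq_epilr R R X Y).
rewrite -[LHS]compA -tens_compl bt_lactE !tens_compl ?compA bt_ractE.
rewrite (post2 (assoc_nat _ _ _)) ?compA tens_id.
rewrite -[RHS]compA assoc_nat ?compA -(compA (bt_lact X Y)) -tens_compr bt_ractE.
rewrite !tens_compr ?compA bt_lactE (post2 (assoc_inv_nat _ _ _)) tens_id ?compA.
rewrite (post2 (tens_swap _ _)) ?compA.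
by rewrite (post2 (esym (pentagon_mixed _ _ _ _))) ?compA (post2 (assocK _ _ _)) compfi.
Qed.

Definition bim_tens X Y : bimodule R :=
  Bimodule (tens_over Co X Y) (bt_lact X Y) (bt_lactA X Y) (bt_lact1 X Y)
    (bt_ract X Y) (bt_ractA X Y) (bt_ract1 X Y) (bt_compat X Y).

Lemma bt_map_subproof {X X' Y Y' : bimodule R}
    (f : bimodule_hom X X') (g : bimodule_hom Y Y') :
  (bq X' Y' ∘ (bmap f ⊗₁ bmap g)) ∘ (bim_ract X ⊗₁ idm (bim_ob Y)) =
  (bq X' Y' ∘ (bmap f ⊗₁ bmap g)) ∘
    ((idm (bim_ob X) ⊗₁ bim_lact Y) ∘ assoc (bim_ob X) R (bim_ob Y)).
Proof.
have [_ fr] := bmapP f; have [gl _] := bmapP g.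
rewrite ?compA (post2 (esym (tens_comp _ _ _ _))) fr compfi.
rewrite (post2 (esym (tens_comp _ _ _ _))) gl compfi.
rewrite -{1}(compif (bmap g)) tens_comp ?compA bqE.
rewrite (post2 (assoc_nat _ _ _)) ?compA (post2 (esym (tens_comp _ _ _ _))).
by rewrite compif.
Qed.

Definition bt_map {X X' Y Y' : bimodule R}
    (f : bimodule_hom X X') (g : bimodule_hom Y Y') :
    hom (tens_over Co X Y) (tens_over Co X' Y') :=
  coeq_desc (bq_coeq X Y) (bt_map_subproof f g).

Lemma bt_mapE {X X' Y Y'} (f : bimodule_hom X X') (g : bimodule_hom Y Y') :
  bt_map f g ∘ bq X Y = bq X' Y' ∘ (bmap f ⊗₁ bmap g).
Proof. exact: coeq_descK. Qed.

Lemma bt_mapP {X X' Y Y'} (f : bimodule_hom X X') (g : bimodule_hom Y Y') :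
  @is_bimodule_map C R (bim_tens X Y) (bim_tens X' Y') (bt_map f g).
Proof.
have [fl _] := bmapP f; have [_ gr] := bmapP g.
split=> /=.
- apply: (bq_epil R X Y).
  rewrite -[LHS]compA bt_lactE ?compA bt_mapE -[RHS]compA -tens_compr bt_mapE.
  rewrite tens_compr ?compA bt_lactE (post2 (assoc_inv_nat _ _ _)) ?compA.
  by rewrite !(post2 (esym (tens_comp _ _ _ _))) fl compfi compif.
- apply: (bq_epir R X Y).
  rewrite -[LHS]compA bt_ractE ?compA bt_mapE -[RHS]compA -tens_compl bt_mapE.
  rewrite tens_compl ?compA bt_ractE (post2 (assoc_nat _ _ _)) ?compA.
  by rewrite !(post2 (esym (tens_comp _ _ _ _))) gr compfi compif.
Qed.

Definition bim_tensm X X' Y Y' (f : bimodule_hom X X') (g : bimodule_hom Y Y') :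
    bimodule_hom (bim_tens X Y) (bim_tens X' Y') :=
  BimoduleHom (bt_map f g) (bt_mapP f g).

(* The associativity constraint is obtained by descending twice: first along
   [bq X Y ⊗₁ idm Z], then along [bq (X ⊗_R Y) Z]; see [bt_assocE]. *)
Lemma bt_assoc1_subproof X Y Z :
  let h := bq X (bim_tens Y Z) ∘ (idm (bim_ob X) ⊗₁ bq Y Z) ∘
    assoc (bim_ob X) (bim_ob Y) (bim_ob Z) in
  h ∘ ((bim_ract X ⊗₁ idm (bim_ob Y)) ⊗₁ idm (bim_ob Z)) =
  h ∘ (((idm (bim_ob X) ⊗₁ bim_lact Y) ∘ assoc (bim_ob X) R (bim_ob Y))
         ⊗₁ idm (bim_ob Z)).
Proof.
rewrite /= tens_compl ?compA !(post2 (assoc_nat _ _ _)) ?compA.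
rewrite tens_id (post2 (esym (tens_swap _ _))) ?compA (bqE X (bim_tens Y Z)) /=.
rewrite -(tens_id (bim_ob X) R) (post2 (assoc_nat _ _ _)) ?compA.
rewrite (post2 (pentagon _ _ _ _)) ?compA.
rewrite -!(compA (bq X (bim_tens Y Z)) (_ ⊗₁ _)) -!tens_compr bt_lactE.
by rewrite (post2 (esym (tens_compr _ _))) -(compA _ (assoc_inv _ _ _)) assocK compfi.
Qed.

Definition bt_assoc1 X Y Z :
    hom (tens_over Co X Y ⊗ bim_ob Z) (tens_over Co X (bim_tens Y Z)) :=
  coeq_desc (bq_coeqr (bim_ob Z) X Y) (bt_assoc1_subproof X Y Z).

Lemma bt_assoc1E X Y Z :
  bt_assoc1 X Y Z ∘ (bq X Y ⊗₁ idm (bim_ob Z)) =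
  bq X (bim_tens Y Z) ∘ (idm (bim_ob X) ⊗₁ bq Y Z) ∘
    assoc (bim_ob X) (bim_ob Y) (bim_ob Z).
Proof. exact: coeq_descK. Qed.

Lemma bt_assoc_subproof X Y Z :
  bt_assoc1 X Y Z ∘ (bt_ract X Y ⊗₁ idm (bim_ob Z)) =
  bt_assoc1 X Y Z ∘ ((idm (tens_over Co X Y) ⊗₁ bim_lact Z) ∘
    assoc (tens_over Co X Y) R (bim_ob Z)).
Proof.
apply: (bq_epirr R (bim_ob Z) X Y).
rewrite -[LHS]compA -tens_compl bt_ractE !tens_compl ?compA bt_assoc1E.
rewrite (post2 (assoc_nat _ _ _)) ?compA -(compA _ _ (idm (bim_ob X) ⊗₁ (_ ⊗₁ _))).
rewrite -tens_compr bqE -[RHS]compA assoc_nat tens_id ?compA.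
rewrite -(compA (bt_assoc1 X Y Z)) -tens_swap ?compA bt_assoc1E.
rewrite -(tens_id (bim_ob X)) (post2 (assoc_nat _ _ _)) ?compA.
by rewrite (post2 (pentagon _ _ _ _)) !tens_compr ?compA.
Qed.

Definition bt_assoc X Y Z :
    hom (tens_over Co (bim_tens X Y) Z) (tens_over Co X (bim_tens Y Z)) :=
  coeq_desc (bq_coeq (bim_tens X Y) Z) (bt_assoc_subproof X Y Z).

Lemma bt_assocE X Y Z :
  bt_assoc X Y Z ∘ bq (bim_tens X Y) Z ∘ (bq X Y ⊗₁ idm (bim_ob Z)) =
  bq X (bim_tens Y Z) ∘ (idm (bim_ob X) ⊗₁ bq Y Z) ∘
    assoc (bim_ob X) (bim_ob Y) (bim_ob Z).
Proof. by rewrite coeq_descK bt_assoc1E. Qed.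

Lemma bt_assoc_inv1_subproof X Y Z :
  let h := bq (bim_tens X Y) Z ∘ (bq X Y ⊗₁ idm (bim_ob Z)) ∘
    assoc_inv (bim_ob X) (bim_ob Y) (bim_ob Z) in
  h ∘ (idm (bim_ob X) ⊗₁ (bim_ract Y ⊗₁ idm (bim_ob Z))) =
  h ∘ (idm (bim_ob X) ⊗₁
         ((idm (bim_ob Y) ⊗₁ bim_lact Z) ∘ assoc (bim_ob Y) R (bim_ob Z))).
Proof.
rewrite /= tens_compr ?compA !(post2 (assoc_inv_nat _ _ _)) ?compA.
rewrite tens_id (post2 (tens_swap _ _)) ?compA.
rewrite (post2 (esym (pentagon_mixed _ _ _ _))) ?compA.
rewrite -(compA _ (bq X Y ⊗₁ _)) -tens_compl.
have -> : bq X Y ∘ (idm (bim_ob X) ⊗₁ bim_ract Y) =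
    bt_ract X Y ∘ (bq X Y ⊗₁ idm R) ∘ assoc_inv (bim_ob X) (bim_ob Y) R.
  by rewrite bt_ractE -[RHS]compA assocVK compfi.
rewrite !tens_compl ?compA (bqE (bim_tens X Y) Z) (post2 (assoc_nat _ _ _)) ?compA.
by rewrite tens_id.
Qed.

Definition bt_assoc_inv1 X Y Z :
    hom (bim_ob X ⊗ tens_over Co Y Z) (tens_over Co (bim_tens X Y) Z) :=
  coeq_desc (bq_coeql (bim_ob X) Y Z) (bt_assoc_inv1_subproof X Y Z).

Lemma bt_assoc_inv1E X Y Z :
  bt_assoc_inv1 X Y Z ∘ (idm (bim_ob X) ⊗₁ bq Y Z) =
  bq (bim_tens X Y) Z ∘ (bq X Y ⊗₁ idm (bim_ob Z)) ∘
    assoc_inv (bim_ob X) (bim_ob Y) (bim_ob Z).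
Proof. exact: coeq_descK. Qed.

Lemma bt_assoc_inv_subproof X Y Z :
  bt_assoc_inv1 X Y Z ∘ (bim_ract X ⊗₁ idm (tens_over Co Y Z)) =
  bt_assoc_inv1 X Y Z ∘ ((idm (bim_ob X) ⊗₁ bt_lact Y Z) ∘
    assoc (bim_ob X) R (tens_over Co Y Z)).
Proof.
apply: (bq_epil (bim_ob X ⊗ R) Y Z).
rewrite -[LHS]compA tens_swap ?compA bt_assoc_inv1E -(tens_id (bim_ob Y) (bim_ob Z)).
rewrite (post2 (assoc_inv_nat _ _ _)) ?compA -(compA _ (bq X Y ⊗₁ _)) -tens_compl bqE.
rewrite -(tens_id (bim_ob X) R) -[RHS]compA assoc_nat ?compA.
rewrite -(compA _ _ (idm (bim_ob X) ⊗₁ (idm R ⊗₁ bq Y Z))) -tens_compr bt_lactE.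
rewrite !tens_compr ?compA bt_assoc_inv1E (post2 (assoc_inv_nat _ _ _)) ?compA.
by rewrite (post3 (pentagon_mixed2 _ _ _ _)) !tens_compl ?compA.
Qed.

Definition bt_assoc_inv X Y Z :
    hom (tens_over Co X (bim_tens Y Z)) (tens_over Co (bim_tens X Y) Z) :=
  coeq_desc (bq_coeq X (bim_tens Y Z)) (bt_assoc_inv_subproof X Y Z).

Lemma bt_assoc_invE X Y Z :
  bt_assoc_inv X Y Z ∘ bq X (bim_tens Y Z) ∘ (idm (bim_ob X) ⊗₁ bq Y Z) =
  bq (bim_tens X Y) Z ∘ (bq X Y ⊗₁ idm (bim_ob Z)) ∘
    assoc_inv (bim_ob X) (bim_ob Y) (bim_ob Z).
Proof. by rewrite coeq_descK bt_assoc_inv1E. Qed.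

Lemma bt_assocK X Y Z :
  bt_assoc_inv X Y Z ∘ bt_assoc X Y Z = idm (tens_over Co (bim_tens X Y) Z).
Proof.
apply: (epi_comp (bq_epi (bim_tens X Y) Z) (bq_epir (bim_ob Z) X Y)).
rewrite ?compA (post3 (bt_assocE _ _ _)) ?compA bt_assoc_invE.
by rewrite -!compA assocK compfi compif.
Qed.

Lemma bt_assocVK X Y Z :
  bt_assoc X Y Z ∘ bt_assoc_inv X Y Z = idm (tens_over Co X (bim_tens Y Z)).
Proof.
apply: (epi_comp (bq_epi X (bim_tens Y Z)) (bq_epil (bim_ob X) Y Z)).
rewrite ?compA (post3 (bt_assoc_invE _ _ _)) ?compA bt_assocE.
by rewrite -!compA assocVK compfi compif.
Qed.

Lemma bt_assocP X Y Z :
  @is_bimodule_map C R (bim_tens (bim_tens X Y) Z) (bim_tens X (bim_tens Y Z))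
    (bt_assoc X Y Z).
Proof.
split=> /=.
- apply: (epi_comp (bq_epil R (bim_tens X Y) Z) (bq_epirl (bim_ob Z) R X Y)).
  rewrite ?compA -2![LHS]compA (compA (bt_lact _ _)) bt_lactE /= ?compA.
  rewrite (post2 (assoc_inv_nat _ _ _)) ?compA.
  rewrite -(compA _ (bt_lact X Y ⊗₁ _)) -tens_compl bt_lactE !tens_compl ?compA.
  rewrite bt_assocE (post2 (assoc_nat _ _ _)) ?compA tens_id.
  rewrite -2![RHS]compA -!tens_compr ?compA bt_assocE !tens_compr ?compA bt_lactE.
  rewrite (post2 (assoc_inv_nat _ _ _)) ?compA tens_id.
  rewrite (post2 (tens_swap (bim_lact X) (bq Y Z))) ?compA.
  by rewrite (post3 (pentagon_mixed _ _ _ _)) ?compA.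
- apply: (epi_comp (bq_epir R (bim_tens X Y) Z) (bq_epirr (bim_ob Z) R X Y)).
  rewrite ?compA -2![LHS]compA (compA (bt_ract _ _)) bt_ractE /= ?compA.
  rewrite (post2 (assoc_nat _ _ _)) ?compA tens_id.
  rewrite (post2 (esym (tens_swap _ _))) ?compA bt_assocE.
  rewrite -(tens_id (bim_ob X)) (post2 (assoc_nat _ _ _)) ?compA.
  rewrite (post2 (pentagon _ _ _ _)) ?compA.
  rewrite -2![RHS]compA -!tens_compl ?compA bt_assocE !tens_compl ?compA bt_ractE.
  rewrite (post2 (assoc_nat _ _ _)) ?compA.
  rewrite -(compA (bq X _) (_ ⊗₁ bim_ract _)) -tens_compr /= bt_ractE.
  by rewrite !tens_compr ?compA.
Qed.

Definition bim_unit : bimodule R :=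
  Bimodule (alg_ob R) (amul R) (amulA R) (amul1l R) (amul R) (amulA R) (amul1r R)
    (amulA R).

Lemma bt_runit_subproof X :
  bim_ract X ∘ (bim_ract X ⊗₁ idm (bim_ob bim_unit)) =
  bim_ract X ∘ ((idm (bim_ob X) ⊗₁ bim_lact bim_unit) ∘ assoc (bim_ob X) R R).
Proof. by rewrite compA; exact: bim_ractA. Qed.

Definition bt_runit X : hom (tens_over Co X bim_unit) (bim_ob X) :=
  coeq_desc (bq_coeq X bim_unit) (bt_runit_subproof X).

Lemma bt_runitE X : bt_runit X ∘ bq X bim_unit = bim_ract X.
Proof. exact: coeq_descK. Qed.

Definition bt_runit_inv X : hom (bim_ob X) (tens_over Co X bim_unit) :=
  bq X bim_unit ∘ (idm (bim_ob X) ⊗₁ aunit R) ∘ runit_inv (bim_ob X).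

Lemma bt_lunit_subproof Y :
  bim_lact Y ∘ (bim_ract bim_unit ⊗₁ idm (bim_ob Y)) =
  bim_lact Y ∘ ((idm (bim_ob bim_unit) ⊗₁ bim_lact Y) ∘ assoc R R (bim_ob Y)).
Proof. by rewrite compA; exact: bim_lactA. Qed.

Definition bt_lunit Y : hom (tens_over Co bim_unit Y) (bim_ob Y) :=
  coeq_desc (bq_coeq bim_unit Y) (bt_lunit_subproof Y).

Lemma bt_lunitE Y : bt_lunit Y ∘ bq bim_unit Y = bim_lact Y.
Proof. exact: coeq_descK. Qed.

Definition bt_lunit_inv Y : hom (bim_ob Y) (tens_over Co bim_unit Y) :=
  bq bim_unit Y ∘ (aunit R ⊗₁ idm (bim_ob Y)) ∘ lunit_inv (bim_ob Y).

Lemma bt_runitK X : bt_runit_inv X ∘ bt_runit X = idm (tens_over Co X bim_unit).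
Proof.
apply: bq_epi; rewrite -[LHS]compA bt_runitE /bt_runit_inv compif.
rewrite (post2 (runit_inv_nat _)) ?compA (post2 (esym (tens_swap _ _))) ?compA.
rewrite (bqE X bim_unit) /= -(tens_id (bim_ob X) R) (post2 (assoc_nat _ _ _)) ?compA.
rewrite (post2 (esym (tens_compr _ _))) amul1r -2![LHS]compA (compA _ (assoc _ _ _)).
by rewrite runit_tens runitVK compfi.
Qed.

Lemma bt_runitVK X : bt_runit X ∘ bt_runit_inv X = idm (bim_ob X).
Proof. by rewrite ?compA bt_runitE bim_ract1 runitVK. Qed.

Lemma bt_runitP X : @is_bimodule_map C R (bim_tens X bim_unit) X (bt_runit X).
Proof.
split=> /=.
- apply: (bq_epil R X bim_unit).
  rewrite -[LHS]compA bt_lactE ?compA bt_runitE bim_compat -[LHS]compA assocVK compfi.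
  by rewrite -[RHS]compA -tens_compr bt_runitE.
- apply: (bq_epir R X bim_unit).
  rewrite -[LHS]compA bt_ractE ?compA bt_runitE -[RHS]compA -tens_compl bt_runitE.
  by rewrite bim_ractA.
Qed.

Lemma bt_lunitK Y : bt_lunit_inv Y ∘ bt_lunit Y = idm (tens_over Co bim_unit Y).
Proof.
apply: bq_epi; rewrite -[LHS]compA bt_lunitE /bt_lunit_inv compif.
rewrite (post2 (lunit_inv_nat _)) ?compA (post2 (tens_swap _ _)) ?compA.
have -> : bq bim_unit Y ∘ (idm R ⊗₁ bim_lact Y) =
    bq bim_unit Y ∘ (amul R ⊗₁ idm (bim_ob Y)) ∘ assoc_inv R R (bim_ob Y).
  by rewrite (bqE bim_unit Y) /= -[RHS]compA assocVK compfi.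
rewrite -(tens_id R (bim_ob Y)) (post2 (assoc_inv_nat _ _ _)) ?compA.
rewrite (post2 (esym (tens_compl _ _))) amul1l -lunit_tens ?compA.
by rewrite (post2 (assocVK _ _ _)) compfi -[LHS]compA lunitVK compfi.
Qed.

Lemma bt_lunitVK Y : bt_lunit Y ∘ bt_lunit_inv Y = idm (bim_ob Y).
Proof. by rewrite ?compA bt_lunitE bim_lact1 lunitVK. Qed.

Lemma bt_lunitP Y : @is_bimodule_map C R (bim_tens bim_unit Y) Y (bt_lunit Y).
Proof.
split=> /=.
- apply: (bq_epil R bim_unit Y).
  rewrite -[LHS]compA bt_lactE ?compA bt_lunitE /= bim_lactA.
  by rewrite -[LHS]compA assocVK compfi -[RHS]compA -tens_compr bt_lunitE.
- apply: (bq_epir R bim_unit Y).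
  rewrite -[LHS]compA bt_ractE ?compA bt_lunitE -[RHS]compA -tens_compl bt_lunitE.
  by rewrite bim_compat.
Qed.

Definition bim_assoc X Y Z :
    bimodule_hom (bim_tens (bim_tens X Y) Z) (bim_tens X (bim_tens Y Z)) :=
  BimoduleHom (bt_assoc X Y Z) (bt_assocP X Y Z).

Definition bim_assoc_inv X Y Z :
    bimodule_hom (bim_tens X (bim_tens Y Z)) (bim_tens (bim_tens X Y) Z) :=
  BimoduleHom (bt_assoc_inv X Y Z)
    (bimodule_invP R _ _ (bt_assocP X Y Z) (bt_assocK X Y Z) (bt_assocVK X Y Z)).

Definition bim_lunit X : bimodule_hom (bim_tens bim_unit X) X :=
  BimoduleHom (bt_lunit X) (bt_lunitP X).

Definition bim_lunit_inv X : bimodule_hom X (bim_tens bim_unit X) :=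
  BimoduleHom (bt_lunit_inv X)
    (bimodule_invP R _ _ (bt_lunitP X) (bt_lunitK X) (bt_lunitVK X)).

Definition bim_runit X : bimodule_hom (bim_tens X bim_unit) X :=
  BimoduleHom (bt_runit X) (bt_runitP X).

Definition bim_runit_inv X : bimodule_hom X (bim_tens X bim_unit) :=
  BimoduleHom (bt_runit_inv X)
    (bimodule_invP R _ _ (bt_runitP X) (bt_runitK X) (bt_runitVK X)).

Lemma bt_map_id X Y : bt_map (bimodule_id R X) (bimodule_id R Y) = idm (tens_over Co X Y).
Proof. by apply: bq_epi; rewrite bt_mapE /= tens_id compfi compif. Qed.

Lemma bt_map_comp {X X' X'' Y Y' Y''} (f' : bimodule_hom X' X'') (f : bimodule_hom X X')
    (g' : bimodule_hom Y' Y'') (g : bimodule_hom Y Y') :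
  bt_map (bimodule_comp R _ _ _ f' f) (bimodule_comp R _ _ _ g' g) =
  bt_map f' g' ∘ bt_map f g.
Proof.
apply: bq_epi; rewrite bt_mapE /= tens_comp -[RHS]compA bt_mapE ?compA.
by rewrite bt_mapE.
Qed.

Lemma bt_assoc_nat {X X' Y Y' Z Z'} (f : bimodule_hom X X') (g : bimodule_hom Y Y')
    (h : bimodule_hom Z Z') :
  bt_assoc X' Y' Z' ∘ bt_map (bim_tensm _ _ _ _ f g) h =
  bt_map f (bim_tensm _ _ _ _ g h) ∘ bt_assoc X Y Z.
Proof.
apply: (epi_comp (bq_epi (bim_tens X Y) Z) (bq_epir (bim_ob Z) X Y)).
rewrite ?compA (post2 (bt_mapE _ _)) ?compA (post2 (esym (tens_comp _ _ _ _))) /=.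
rewrite compfi bt_mapE -(compif (bmap h)) tens_comp ?compA bt_assocE.
rewrite (post2 (assoc_nat _ _ _)) ?compA (post2 (esym (tens_comp _ _ _ _))).
rewrite (post3 (bt_assocE _ _ _)) ?compA bt_mapE.
by rewrite (post2 (esym (tens_comp _ _ _ _))) /= compfi compif bt_mapE.
Qed.

Lemma bt_lunit_nat {X Y} (f : bimodule_hom X Y) :
  bt_lunit Y ∘ bt_map (bimodule_id R bim_unit) f = bmap f ∘ bt_lunit X.
Proof.
have [fl _] := bmapP f.
apply: bq_epi; rewrite -[LHS]compA bt_mapE ?compA bt_lunitE -[RHS]compA bt_lunitE.
by rewrite fl.
Qed.

Lemma bt_runit_nat {X Y} (f : bimodule_hom X Y) :
  bt_runit Y ∘ bt_map f (bimodule_id R bim_unit) = bmap f ∘ bt_runit X.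
Proof.
have [_ fr] := bmapP f.
apply: bq_epi; rewrite -[LHS]compA bt_mapE ?compA bt_runitE -[RHS]compA bt_runitE.
by rewrite fr.
Qed.

Lemma bt_pentagon W X Y Z :
  bt_assoc W X (bim_tens Y Z) ∘ bt_assoc (bim_tens W X) Y Z =
  bt_map (bimodule_id R W) (bim_assoc X Y Z) ∘ bt_assoc W (bim_tens X Y) Z ∘
    bt_map (bim_assoc W X Y) (bimodule_id R Z).
Proof.
apply: (epi_comp (bq_epi (bim_tens (bim_tens W X) Y) Z)
  (epi_comp (bq_epir (bim_ob Z) (bim_tens W X) Y) (bq_epirr (bim_ob Y) (bim_ob Z) W X))).
rewrite ?compA (post3 (bt_assocE (bim_tens W X) Y Z)) ?compA.
rewrite (post2 (assoc_nat _ _ _)) ?compA tens_id.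
rewrite (post2 (esym (tens_swap (bq W X) (bq Y Z)))) ?compA.
rewrite (bt_assocE W X (bim_tens Y Z)).
rewrite -(tens_id (bim_ob W)) (post2 (assoc_nat _ _ _)) ?compA.
rewrite (post2 (pentagon _ _ _ _)) ?compA.
rewrite (post2 (bt_mapE _ _)) ?compA /=.
rewrite -2![RHS]compA -!tens_compl ?compA bt_assocE !tens_compl ?compA.
rewrite (post3 (bt_assocE W (bim_tens X Y) Z)) ?compA (post2 (assoc_nat _ _ _)) ?compA.
rewrite bt_mapE /=.
rewrite -2!(compA (bq W _) (idm (bim_ob W) ⊗₁ _)) -!tens_compr ?compA.
rewrite -2!(compA (bq W _) (idm (bim_ob W) ⊗₁ _)) -!tens_compr.
by rewrite bt_assocE !tens_compr ?compA.
Qed.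

Lemma bt_triangle X Y :
  bt_map (bimodule_id R X) (bim_lunit Y) ∘ bt_assoc X bim_unit Y =
  bt_map (bim_runit X) (bimodule_id R Y).
Proof.
apply: (epi_comp (bq_epi (bim_tens X bim_unit) Y) (bq_epir (bim_ob Y) X bim_unit)).
rewrite ?compA (post3 (bt_assocE X bim_unit Y)) ?compA !bt_mapE /=.
rewrite -(compA (bq X Y)) -tens_compr bt_lunitE.
by rewrite -[RHS]compA -tens_compl bt_runitE bqE.
Qed.

End BimoduleTensor.

Definition bimodule_monoidal {C : monoidal_category} (Co : has_coequalizers C)
  (coflatC : forall X : C, coflat X) (R : algebra C) : monoidal_category.
Proof.
refine (@MonoidalCategory (bimodule_category R)
  (bim_tens Co coflatC) (bim_tensm Co coflatC) bim_unit _ _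
  (bim_assoc Co coflatC) (bim_assoc_inv Co coflatC) _ _ _
  (bim_lunit Co coflatC) (bim_lunit_inv Co coflatC) _ _ _
  (bim_runit Co coflatC) (bim_runit_inv Co coflatC) _ _ _ _ _).
- by move=> X Y; apply: bimodule_hom_eq; exact: bt_map_id.
- by move=> *; apply: bimodule_hom_eq; exact: bt_map_comp.
- by move=> *; apply: bimodule_hom_eq; exact: bt_assocK.
- by move=> *; apply: bimodule_hom_eq; exact: bt_assocVK.
- by move=> *; apply: bimodule_hom_eq; exact: bt_assoc_nat.
- by move=> *; apply: bimodule_hom_eq; exact: bt_lunitK.
- by move=> *; apply: bimodule_hom_eq; exact: bt_lunitVK.
- by move=> *; apply: bimodule_hom_eq; exact: bt_lunit_nat.
- by move=> *; apply: bimodule_hom_eq; exact: bt_runitK.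
- by move=> *; apply: bimodule_hom_eq; exact: bt_runitVK.
- by move=> *; apply: bimodule_hom_eq; exact: bt_runit_nat.
- by move=> *; apply: bimodule_hom_eq; exact: bt_pentagon.
- by move=> *; apply: bimodule_hom_eq; exact: bt_triangle.
Defined.

Record monoidal_structure {A D : monoidal_category} (F : functor A D) :=
  MonoidalStructure {
  phi2 : forall X Y : A, hom (F X ⊗ F Y) (F (X ⊗ Y));
  phi0 : hom 𝟏 (F 𝟏);
  phi2_nat : forall (X X' Y Y' : A) (f : hom X X') (g : hom Y Y'),
    phi2 X' Y' ∘ (fmap F f ⊗₁ fmap F g) = fmap F (f ⊗₁ g) ∘ phi2 X Y;
  phi2_assoc : forall X Y Z : A,
    fmap F (assoc X Y Z) ∘ phi2 (X ⊗ Y) Z ∘ (phi2 X Y ⊗₁ idm (F Z)) =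
    phi2 X (Y ⊗ Z) ∘ (idm (F X) ⊗₁ phi2 Y Z) ∘ assoc (F X) (F Y) (F Z);
  phi2_unitl : forall X : A,
    fmap F (lunit X) ∘ phi2 𝟏 X ∘ (phi0 ⊗₁ idm (F X)) = lunit (F X);
  phi2_unitr : forall X : A,
    fmap F (runit X) ∘ phi2 X 𝟏 ∘ (idm (F X) ⊗₁ phi0) = runit (F X) }.

Arguments phi2 {A D F} m X Y.
Arguments phi0 {A D F} m.

Record opmonoidal_structure {A D : monoidal_category} (F : functor A D) :=
  OpmonoidalStructure {
  psi2 : forall X Y : A, hom (F (X ⊗ Y)) (F X ⊗ F Y);
  psi0 : hom (F 𝟏) 𝟏;
  psi2_nat : forall (X X' Y Y' : A) (f : hom X X') (g : hom Y Y'),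
    psi2 X' Y' ∘ fmap F (f ⊗₁ g) = (fmap F f ⊗₁ fmap F g) ∘ psi2 X Y;
  psi2_assoc : forall X Y Z : A,
    assoc (F X) (F Y) (F Z) ∘ (psi2 X Y ⊗₁ idm (F Z)) ∘ psi2 (X ⊗ Y) Z =
    (idm (F X) ⊗₁ psi2 Y Z) ∘ psi2 X (Y ⊗ Z) ∘ fmap F (assoc X Y Z);
  psi2_unitl : forall X : A,
    lunit (F X) ∘ (psi0 ⊗₁ idm (F X)) ∘ psi2 𝟏 X = fmap F (lunit X);
  psi2_unitr : forall X : A,
    runit (F X) ∘ (idm (F X) ⊗₁ psi0) ∘ psi2 X 𝟏 = fmap F (runit X) }.

Arguments psi2 {A D F} o X Y.
Arguments psi0 {A D F} o.

Definition frobenius_monoidal {A D : monoidal_category} {F : functor A D}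
    (phi : monoidal_structure F) (psi : opmonoidal_structure F) : Prop :=
  forall X Y Z : A,
    (idm (F X) ⊗₁ phi2 phi Y Z) ∘ assoc (F X) (F Y) (F Z) ∘
      (psi2 psi X Y ⊗₁ idm (F Z)) =
    psi2 psi X (Y ⊗ Z) ∘ fmap F (assoc X Y Z) ∘ phi2 phi (X ⊗ Y) Z
  /\
    (phi2 phi X Y ⊗₁ idm (F Z)) ∘ assoc_inv (F X) (F Y) (F Z) ∘
      (idm (F X) ⊗₁ psi2 psi Y Z) =
    psi2 psi (X ⊗ Y) Z ∘ fmap F (assoc_inv X Y Z) ∘ phi2 phi X (Y ⊗ Z).

Section Forgetful.
Context {C : monoidal_category} (Co : has_coequalizers C).
Context (coflatC : forall X : C, coflat X) (R : algebra C).

Definition forgetful : functor (bimodule_monoidal Co coflatC R) C :=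
  @Functor (bimodule_category R) C (@bim_ob C R) (@bmap C R)
    (fun=> erefl) (fun _ _ _ _ _ => erefl).

Definition forgetful_monoidal : monoidal_structure forgetful.
Proof.
refine (@MonoidalStructure _ _ forgetful
  (fun X Y : bimodule R => qmap Co X Y) (aunit R) _ _ _ _).
- by move=> X X' Y Y' f g; rewrite [RHS](bt_mapE Co).
- by move=> X Y Z; exact: (bt_assocE Co coflatC X Y Z).
- by move=> X; exact: (etrans (f_equal (comp^~ (aunit R ⊗₁ _)) (bt_lunitE Co X)) (bim_lact1 X)).
- by move=> X; exact: (etrans (f_equal (comp^~ (_ ⊗₁ aunit R)) (bt_runitE Co X)) (bim_ract1 X)).
Defined.

End Forgetful.

Definition frobenius_pair {C : monoidal_category} (R : algebra C)
    (theta : hom R 𝟏) (e : hom 𝟏 (R ⊗ R)) : Prop :=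
  (amul R ⊗₁ idm R) ∘ assoc_inv R R R ∘ (idm R ⊗₁ e) ∘ runit_inv R =
    (idm R ⊗₁ amul R) ∘ assoc R R R ∘ (e ⊗₁ idm R) ∘ lunit_inv R /\
  lunit R ∘ (theta ⊗₁ idm R) ∘ e = aunit R /\
  runit R ∘ (idm R ⊗₁ theta) ∘ e = aunit R.

Definition frobenius_algebra {C : monoidal_category} (R : algebra C) : Prop :=
  exists (theta : hom R 𝟏) (e : hom 𝟏 (R ⊗ R)), frobenius_pair R theta e.

(* Main.v *)
(* For any e : 1 -> R ⊗ R, inserting e between X and Y and letting its two legs
   act gives an endomorphism of X ⊗ Y, natural and compatible with tensoring on
   either side.  The Casimir equation for e makes this map
   R-balanced, so it descends to psi : X ⊗_R Y -> X ⊗ Y, and the opmonoidal and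
   Frobenius axioms are read off before descending.  Conversely, the two
   Frobenius conditions with R in the middle, composed with the unit
   isomorphisms, express psi_{X,Y} q through psi_{X,R}, and psi_{X,R} through
   psi_{R,R}; hence psi is an insertion, of e = psi_{R,R} r^-1 eta. *)
From Corelib Require Import ssreflect ssrfun.
Require Import Defs.

Lemma triangle_inv {C : monoidal_category} (X Y : C) :
  assoc_inv X 𝟏 Y ∘ (idm X ⊗₁ lunit_inv Y) = runit_inv X ⊗₁ idm Y.
Proof.
rewrite -[RHS]compif -(assocK X 𝟏 Y) -?compA; congr (_ ∘ _).
rewrite -[RHS]compif -tens_id -(lunitK Y) tens_compr -compA -[LHS]compfi.
congr (_ ∘ _).
by rewrite compA triangle -tens_compl runitVK tens_id.
Qed.

(** * Insertion of a copairing between two actions *)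

Section Insertion.
Context {C : monoidal_category} {R : C} (e : hom 𝟏 (R ⊗ R)).

(** For [X = R] and the multiplication as action, [rcoact] and [lcoact] are the two sides of the
    Casimir equation. *)
Definition rcoact {X : C} (nu : hom (X ⊗ R) X) : hom X (X ⊗ R) :=
  (nu ⊗₁ idm R) ∘ assoc_inv X R R ∘ (idm X ⊗₁ e) ∘ runit_inv X.

Definition lcoact {Y : C} (mu : hom (R ⊗ Y) Y) : hom Y (R ⊗ Y) :=
  (idm R ⊗₁ mu) ∘ assoc R R Y ∘ (e ⊗₁ idm Y) ∘ lunit_inv Y.

(** With e = e' ⊗ e'', this is x ⊗ y ↦ x e' ⊗ e'' y. *)
Definition insertion {X Y : C} (nu : hom (X ⊗ R) X) (mu : hom (R ⊗ Y) Y) :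
    hom (X ⊗ Y) (X ⊗ Y) :=
  (idm X ⊗₁ mu) ∘ assoc X R Y ∘ (rcoact nu ⊗₁ idm Y).

Lemma insertionE {X Y : C} (nu : hom (X ⊗ R) X) (mu : hom (R ⊗ Y) Y) :
  insertion nu mu =
  (nu ⊗₁ mu) ∘ assoc (X ⊗ R) R Y ∘ (assoc_inv X R R ⊗₁ idm Y) ∘
    ((idm X ⊗₁ e) ⊗₁ idm Y) ∘ (runit_inv X ⊗₁ idm Y).
Proof.
rewrite /insertion /rcoact !tens_compl ?compA (post2 (assoc_nat _ _ _)) ?compA.
by rewrite tens_id tens_rl.
Qed.

Lemma insertion_lcoact {X Y : C} (nu : hom (X ⊗ R) X) (mu : hom (R ⊗ Y) Y) :
  insertion nu mu = (nu ⊗₁ idm Y) ∘ assoc_inv X R Y ∘ (idm X ⊗₁ lcoact mu).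
Proof.
rewrite insertionE /lcoact !tens_compr ?compA (post2 (assoc_inv_nat _ _ _)) ?compA.
rewrite tens_id tens_lr (post2 (esym (pentagon_mixed _ _ _ _))) ?compA.
by rewrite (post2 (assoc_inv_nat _ _ _)) ?compA (post2 (triangle_inv _ _)).
Qed.

Lemma rcoact_nat {X X' : C} (nu : hom (X ⊗ R) X) (nu' : hom (X' ⊗ R) X') (f : hom X X') :
  f ∘ nu = nu' ∘ (f ⊗₁ idm R) -> rcoact nu' ∘ f = (f ⊗₁ idm R) ∘ rcoact nu.
Proof.
move=> fr; rewrite /rcoact ?compA -tens_compl fr tens_compl.
rewrite (post2 (runit_inv_nat _)) ?compA (post2 (esym (tens_swap _ _))) ?compA.
by rewrite -(tens_id R R) (post2 (assoc_inv_nat _ _ _)) ?compA.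
Qed.

(** Only intertwining of [nu] and [mu] matters, so [f] and [g] may themselves be actions, quotient
    maps or insertions; this drives most later arguments. *)
Lemma insertion_nat {X X' Y Y' : C} (nu : hom (X ⊗ R) X) (nu' : hom (X' ⊗ R) X')
    (mu : hom (R ⊗ Y) Y) (mu' : hom (R ⊗ Y') Y') (f : hom X X') (g : hom Y Y') :
  f ∘ nu = nu' ∘ (f ⊗₁ idm R) -> g ∘ mu = mu' ∘ (idm R ⊗₁ g) ->
  insertion nu' mu' ∘ (f ⊗₁ g) = (f ⊗₁ g) ∘ insertion nu mu.
Proof.
move=> fr gl; rewrite /insertion (post2 (esym (tens_comp _ _ _ _))).
rewrite (rcoact_nat _ _ _ fr) compif -{1}(compfi g) tens_comp ?compA.
rewrite (post2 (assoc_nat _ _ _)) ?compA -!tens_comp.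
by rewrite !compif !compfi gl.
Qed.

Lemma insertion_tensl {X Y Z : C} (nu : hom (Y ⊗ R) Y) (mu : hom (R ⊗ Z) Z) :
  insertion ((idm X ⊗₁ nu) ∘ assoc X Y R) mu =
  assoc_inv X Y Z ∘ (idm X ⊗₁ insertion nu mu) ∘ assoc X Y Z.
Proof.
rewrite !insertion_lcoact; move: (lcoact mu) => l; rewrite !tens_compr !tens_compl ?compA.
rewrite assoc_inv_nat -[RHS]compA -assoc_nat ?compA tens_id.
by rewrite (post3 (pentagon_mixed2 _ _ _ _)) ?compA.
Qed.

Lemma insertion_tensr {X Y Z : C} (nu : hom (X ⊗ R) X) (mu : hom (R ⊗ Y) Y) :
  insertion nu ((mu ⊗₁ idm Z) ∘ assoc_inv R Y Z) =
  assoc X Y Z ∘ (insertion nu mu ⊗₁ idm Z) ∘ assoc_inv X Y Z.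
Proof.
rewrite /insertion; move: (rcoact nu) => r; rewrite !tens_compr !tens_compl ?compA.
rewrite assoc_nat -[RHS]compA -assoc_inv_nat ?compA tens_id.
rewrite (post2 (esym (pentagon_mixed2 _ _ _ _))) ?compA.
by rewrite (post2 (assocVK _ _ _)) compfi.
Qed.

(** One insertion acts on [Y] from the left, the other from the right. By naturality it is enough
    that the second is left linear, which is naturality again, now along [muY]. *)
Lemma insertion_comm {X Y Z : C} (nuX : hom (X ⊗ R) X) (muY : hom (R ⊗ Y) Y)
    (nuY : hom (Y ⊗ R) Y) (muZ : hom (R ⊗ Z) Z) :
  nuY ∘ (muY ⊗₁ idm R) = muY ∘ (idm R ⊗₁ nuY) ∘ assoc R Y R ->
  assoc X Y Z ∘ (insertion nuX muY ⊗₁ idm Z) ∘ assoc_inv X Y Z ∘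
    (idm X ⊗₁ insertion nuY muZ) =
  (idm X ⊗₁ insertion nuY muZ) ∘ assoc X Y Z ∘ (insertion nuX muY ⊗₁ idm Z) ∘
    assoc_inv X Y Z.
Proof.
move=> compat; rewrite -!(compA (idm X ⊗₁ _)) -insertion_tensr.
apply: insertion_nat; first by rewrite tens_id compfi compif.
rewrite compA (insertion_nat ((idm R ⊗₁ nuY) ∘ assoc R Y R) nuY muZ muZ).
- by rewrite compat compA.
- by rewrite tens_id compfi compif.
- by rewrite insertion_tensl -!compA assocVK compfi.
Qed.

End Insertion.


(** * Consequences of the Casimir and counit equations *)

Section FrobeniusPair.
Context {C : monoidal_category} {R : algebra C} {theta : hom R 𝟏} {e : hom 𝟏 (R ⊗ R)}.
Context (fp : frobenius_pair R theta e).

Lemma frobenius_coact : rcoact e (amul R) = lcoact e (amul R).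
Proof. exact: (proj1 fp). Qed.

(** In the form [lcoact], [theta] meets the first leg of [e] unmultiplied, so the counit equation
    applies. *)
Lemma frobenius_counitl : lunit R ∘ (theta ⊗₁ idm R) ∘ rcoact e (amul R) = idm R.
Proof.
rewrite frobenius_coact /lcoact ?compA (post2 (tens_swap _ _)) ?compA lunit_nat.
rewrite -(tens_id R R) (post2 (esym (assoc_nat _ _ _))) ?compA.
rewrite (post2 (lunit_tens _ _)) -2!(compA (amul R)) -!tens_compl.
by rewrite (proj1 (proj2 fp)) amul1l lunitVK.
Qed.

Lemma frobenius_counitr : runit R ∘ (idm R ⊗₁ theta) ∘ rcoact e (amul R) = idm R.
Proof.
rewrite /rcoact ?compA (post2 (esym (tens_swap _ _))) ?compA runit_nat.
rewrite -(tens_id R R) (post2 (esym (assoc_inv_nat _ _ _))) ?compA.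
rewrite -runit_tens ?compA (post2 (assocVK _ _ _)) compfi -2!(compA (amul R)).
by rewrite -!tens_compr (proj2 (proj2 fp)) amul1r runitVK.
Qed.

(** Associativity says that [nu] intertwines right multiplication on [X ⊗ R] with [nu]. *)
Lemma insertion_ract {X Y : C} (nu : hom (X ⊗ R) X) (mu : hom (R ⊗ Y) Y) :
  nu ∘ (nu ⊗₁ idm R) = nu ∘ (idm X ⊗₁ amul R) ∘ assoc X R R ->
  insertion e nu mu ∘ (nu ⊗₁ idm Y) =
  (nu ⊗₁ idm Y) ∘ assoc_inv X R Y ∘ (idm X ⊗₁ insertion e (amul R) mu) ∘ assoc X R Y.
Proof.
move=> nuA; rewrite (insertion_nat _ ((idm X ⊗₁ amul R) ∘ assoc X R R) nu mu mu).
- by rewrite compA nuA.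
- by rewrite tens_id compfi compif.
- by rewrite insertion_tensl ?compA.
Qed.

Lemma insertion_lact {X Y : C} (nu : hom (X ⊗ R) X) (mu : hom (R ⊗ Y) Y) :
  mu ∘ (amul R ⊗₁ idm Y) = mu ∘ (idm R ⊗₁ mu) ∘ assoc R R Y ->
  insertion e nu mu ∘ (idm X ⊗₁ mu) =
  (idm X ⊗₁ mu) ∘ assoc X R Y ∘ (insertion e nu (amul R) ⊗₁ idm Y) ∘ assoc_inv X R Y.
Proof.
move=> muA.
rewrite (insertion_nat _ nu nu ((amul R ⊗₁ idm Y) ∘ assoc_inv R R Y) mu).
- by rewrite tens_id compfi compif.
- by rewrite compA muA -[LHS]compA assocVK compfi.
- by rewrite insertion_tensr ?compA.
Qed.

(** By associativity the sides are x (r e') ⊗ e'' y and x e' ⊗ (e'' r) y, equal by the Casimir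
    equation. *)
Lemma insertion_balanced {X Y : C} (nu : hom (X ⊗ R) X) (mu : hom (R ⊗ Y) Y) :
  nu ∘ (nu ⊗₁ idm R) = nu ∘ (idm X ⊗₁ amul R) ∘ assoc X R R ->
  mu ∘ (amul R ⊗₁ idm Y) = mu ∘ (idm R ⊗₁ mu) ∘ assoc R R Y ->
  insertion e nu mu ∘ (nu ⊗₁ idm Y) =
  insertion e nu mu ∘ ((idm X ⊗₁ mu) ∘ assoc X R Y).
Proof.
move=> nuA muA; rewrite (insertion_ract _ _ nuA) ?compA (insertion_lact _ _ muA).
(* Both sides now contain the same map [lcoact e (amul R)]; the rest is coherence. *)
rewrite (post2 (assocK _ _ _)) compfi {1}/insertion frobenius_coact insertion_lcoact.
move: (lcoact e (amul R)) => d; rewrite !tens_compr !tens_compl ?compA.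
rewrite (post2 (assoc_nat _ _ _)) ?compA (post2 (assoc_inv_nat _ _ _)) ?compA.
rewrite !tens_id tens_lr tens_rl (post2 (esym (pentagon_mixed _ _ _ _))) ?compA.
by rewrite (post2 (assoc_inv_nat _ _ _)) ?compA -[LHS]compA assocK compfi.
Qed.

End FrobeniusPair.

(** * The opmonoidal structure induced by a Frobenius pair *)

Section InducedOpmonoidal.
Context {C : monoidal_category} (Co : has_coequalizers C).
Context (coflatC : forall X : C, coflat X) {R : algebra C}.
Context {theta : hom R 𝟏} {e : hom 𝟏 (R ⊗ R)} (fp : frobenius_pair R theta e).
Implicit Types X Y Z : bimodule R.

Definition bim_insertion X Y : hom (bim_ob X ⊗ bim_ob Y) (bim_ob X ⊗ bim_ob Y) :=
  insertion e (bim_ract X) (bim_lact Y).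

Definition bt_split X Y : hom (tens_over Co X Y) (bim_ob X ⊗ bim_ob Y) :=
  coeq_desc (bq_coeq Co X Y) (insertion_balanced fp _ _ (bim_ractA X) (bim_lactA Y)).

Lemma bt_splitE X Y : bt_split X Y ∘ bq Co X Y = bim_insertion X Y.
Proof. exact: coeq_descK. Qed.

(** The left action of [bim_tens] descends from the one on [Y], so [bq] intertwines them and
    naturality applies. *)
Lemma bim_insertion_bq_r X Y Z :
  bim_insertion X (bim_tens Co coflatC Y Z) ∘ (idm (bim_ob X) ⊗₁ bq Co Y Z) =
  (idm (bim_ob X) ⊗₁ bq Co Y Z) ∘ assoc _ _ _ ∘ (bim_insertion X Y ⊗₁ idm (bim_ob Z)) ∘
    assoc_inv _ _ _.
Proof.
rewrite /bim_insertion (insertion_nat _ (bim_ract X) _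
  ((bim_lact Y ⊗₁ idm (bim_ob Z)) ∘ assoc_inv R (bim_ob Y) (bim_ob Z))).
- by rewrite tens_id compfi compif.
- by rewrite bt_lactE compA.
- by rewrite insertion_tensr ?compA.
Qed.

Lemma bim_insertion_bq_l X Y Z :
  bim_insertion (bim_tens Co coflatC X Y) Z ∘ (bq Co X Y ⊗₁ idm (bim_ob Z)) =
  (bq Co X Y ⊗₁ idm (bim_ob Z)) ∘ assoc_inv _ _ _ ∘ (idm (bim_ob X) ⊗₁ bim_insertion Y Z) ∘
    assoc _ _ _.
Proof.
rewrite /bim_insertion (insertion_nat _
  ((idm (bim_ob X) ⊗₁ bim_ract Y) ∘ assoc (bim_ob X) (bim_ob Y) R) _ (bim_lact Z)).
- by rewrite bt_ractE compA.
- by rewrite tens_id compfi compif.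
- by rewrite insertion_tensl ?compA.
Qed.

Lemma bt_split_nat {X X' Y Y'} (f : bimodule_hom X X') (g : bimodule_hom Y Y') :
  bt_split X' Y' ∘ bt_map Co f g = (bmap f ⊗₁ bmap g) ∘ bt_split X Y.
Proof.
have [_ fr] := bmapP f; have [gl _] := bmapP g.
apply: (bq_epi Co); rewrite -[LHS]compA bt_mapE compA bt_splitE -[RHS]compA bt_splitE.
exact: insertion_nat.
Qed.

Lemma bt_split_frobl X Y Z :
  (idm (bim_ob X) ⊗₁ bq Co Y Z) ∘ assoc (bim_ob X) (bim_ob Y) (bim_ob Z) ∘
    (bt_split X Y ⊗₁ idm (bim_ob Z)) =
  bt_split X (bim_tens Co coflatC Y Z) ∘ bt_assoc Co coflatC X Y Z ∘
    bq Co (bim_tens Co coflatC X Y) Z.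
Proof.
apply: (bq_epir Co coflatC); rewrite -[LHS]compA -tens_compl bt_splitE.
rewrite (post3 (bt_assocE _ _ _ _ _)) ?compA bt_splitE bim_insertion_bq_r.
by rewrite -[RHS]compA assocK compfi.
Qed.

Lemma bt_split_frobr X Y Z :
  (bq Co X Y ⊗₁ idm (bim_ob Z)) ∘ assoc_inv (bim_ob X) (bim_ob Y) (bim_ob Z) ∘
    (idm (bim_ob X) ⊗₁ bt_split Y Z) =
  bt_split (bim_tens Co coflatC X Y) Z ∘ bt_assoc_inv Co coflatC X Y Z ∘
    bq Co X (bim_tens Co coflatC Y Z).
Proof.
apply: (bq_epil Co coflatC); rewrite -[LHS]compA -tens_compr bt_splitE.
rewrite (post3 (bt_assoc_invE _ _ _ _ _)) ?compA bt_splitE bim_insertion_bq_l.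
by rewrite -[RHS]compA assocVK compfi.
Qed.

(** Pulled back along the quotient maps, both sides are the same two insertions in opposite orders,
    which commute because [Y] is a bimodule. *)
Lemma bt_split_assoc X Y Z :
  assoc (bim_ob X) (bim_ob Y) (bim_ob Z) ∘ (bt_split X Y ⊗₁ idm (bim_ob Z)) ∘
    bt_split (bim_tens Co coflatC X Y) Z =
  (idm (bim_ob X) ⊗₁ bt_split Y Z) ∘ bt_split X (bim_tens Co coflatC Y Z) ∘
    bt_assoc Co coflatC X Y Z.
Proof.
apply: (epi_comp (bq_epi Co (bim_tens Co coflatC X Y) Z) (bq_epir Co coflatC (bim_ob Z) X Y)).
rewrite ?compA (post2 (bt_splitE _ _)) (post2 (bim_insertion_bq_l _ _ _)) ?compA.
rewrite (post2 (esym (tens_compl _ _))) bt_splitE.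
rewrite (post3 (bt_assocE _ _ _ _ _)) ?compA (post2 (bt_splitE _ _)).
rewrite (post2 (bim_insertion_bq_r _ _ _)) ?compA -tens_compr bt_splitE; congr (_ ∘ _).
exact: insertion_comm (bim_compat Y).
Qed.

Lemma bt_split_unitl X :
  lunit (bim_ob X) ∘ (theta ⊗₁ idm (bim_ob X)) ∘ bt_split (bim_unit (R := R)) X = bt_lunit Co X.
Proof.
apply: (bq_epi Co); rewrite -[LHS]compA bt_splitE bt_lunitE /bim_insertion /insertion /= ?compA.
rewrite (post2 (tens_swap _ _)) ?compA lunit_nat -tens_id.
rewrite (post2 (esym (assoc_nat _ _ _))) ?compA (post2 (lunit_tens _ _)).
by rewrite -2![LHS]compA -!tens_compl (compA (lunit _)) frobenius_counitl // tens_id compfi.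
Qed.

Lemma bt_split_unitr X :
  runit (bim_ob X) ∘ (idm (bim_ob X) ⊗₁ theta) ∘ bt_split X (bim_unit (R := R)) = bt_runit Co X.
Proof.
apply: (bq_epi Co); rewrite -[LHS]compA bt_splitE bt_runitE /bim_insertion insertion_lcoact /= ?compA.
rewrite (post2 (esym (tens_swap _ _))) ?compA runit_nat -tens_id.
rewrite (post2 (esym (assoc_inv_nat _ _ _))) ?compA -runit_tens ?compA.
(* The Casimir equation brings the left coaction into the form of [frobenius_counitr]. *)
rewrite (post2 (assocVK _ _ _)) compfi -(frobenius_coact fp).
by rewrite -2![LHS]compA -!tens_compr (compA (runit _)) frobenius_counitr // tens_id compfi.
Qed.

Definition forgetful_opmonoidal : opmonoidal_structure (forgetful Co coflatC R) :=
  @OpmonoidalStructure _ _ (forgetful Co coflatC R) bt_split theta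
    (@bt_split_nat) bt_split_assoc bt_split_unitl bt_split_unitr.

Lemma forgetful_frobenius :
  frobenius_monoidal (forgetful_monoidal Co coflatC R) forgetful_opmonoidal.
Proof. by move=> X Y Z; split; [exact: bt_split_frobl | exact: bt_split_frobr]. Qed.

End InducedOpmonoidal.

(** * The Frobenius pair of a Frobenius opmonoidal structure *)

Section PairOfOpmonoidal.
Context {C : monoidal_category} (Co : has_coequalizers C).
Context (coflatC : forall X : C, coflat X) {R : algebra C}.
Context (psi : opmonoidal_structure (forgetful Co coflatC R)).
Context (frob : frobenius_monoidal (forgetful_monoidal Co coflatC R) psi).
Implicit Types X Y Z : bimodule R.
Local Notation bunit := (@bim_unit C R).

(* [psi2 psi] with its type written through [bim_ob], for rewriting. *)
Definition bpsi X Y : hom (tens_over Co X Y) (bim_ob X ⊗ bim_ob Y) := psi2 psi X Y.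

Definition psi_copair : hom 𝟏 (R ⊗ R) :=
  bpsi bunit bunit ∘ bt_runit_inv Co bunit ∘ aunit R.

Lemma bpsi_nat {X X' Y Y'} (f : bimodule_hom X X') (g : bimodule_hom Y Y') :
  bpsi X' Y' ∘ bt_map Co f g = (bmap f ⊗₁ bmap g) ∘ bpsi X Y.
Proof. exact: (psi2_nat _ psi _ _ _ _ f g). Qed.

Lemma bpsi_frobl X Y Z :
  (idm (bim_ob X) ⊗₁ bq Co Y Z) ∘ assoc (bim_ob X) (bim_ob Y) (bim_ob Z) ∘
    (bpsi X Y ⊗₁ idm (bim_ob Z)) =
  bpsi X (bim_tens Co coflatC Y Z) ∘ bt_assoc Co coflatC X Y Z ∘
    bq Co (bim_tens Co coflatC X Y) Z.
Proof. exact: (proj1 (frob X Y Z)). Qed.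

Lemma bpsi_frobr X Y Z :
  (bq Co X Y ⊗₁ idm (bim_ob Z)) ∘ assoc_inv (bim_ob X) (bim_ob Y) (bim_ob Z) ∘
    (idm (bim_ob X) ⊗₁ bpsi Y Z) =
  bpsi (bim_tens Co coflatC X Y) Z ∘ bt_assoc_inv Co coflatC X Y Z ∘
    bq Co X (bim_tens Co coflatC Y Z).
Proof. exact: (proj2 (frob X Y Z)). Qed.

(** In the first Frobenius condition at [X], [bunit], [Z], compose with the left unit constraint of
    [Z]. Naturality of psi and the triangle turn the associator into the right unit constraint of
    [X], which cancels its inverse. *)
Lemma bpsi_bql X Z :
  bpsi X Z ∘ bq Co X Z =
  (idm (bim_ob X) ⊗₁ bim_lact Z) ∘ assoc (bim_ob X) R (bim_ob Z) ∘
    ((bpsi X bunit ∘ bt_runit_inv Co X) ⊗₁ idm (bim_ob Z)).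
Proof.
have tri := bt_triangle Co coflatC X Z.
have nat1 := bpsi_nat (bimodule_id R X) (bim_lunit Co coflatC Z).
have nat2 := bt_mapE Co (bim_runit Co coflatC X) (bimodule_id R Z).
rewrite -(bt_lunitE Co Z) tens_compr tens_compl ?compA.
rewrite (post3 (bpsi_frobl X bunit Z)) ?compA.
rewrite -[X in X ∘ bt_assoc _ _ _ _ _]nat1.
rewrite (post2 tri) (post2 nat2).
by rewrite -!compA -tens_comp bt_runitVK compfi tens_id compfi.
Qed.

Lemma bpsi_bqr X Z :
  bpsi X Z ∘ bq Co X Z =
  (bim_ract X ⊗₁ idm (bim_ob Z)) ∘ assoc_inv (bim_ob X) R (bim_ob Z) ∘
    (idm (bim_ob X) ⊗₁ (bpsi bunit Z ∘ bt_lunit_inv Co Z)).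
Proof.
have tri := bt_triangle Co coflatC X Z.
have nat1 := bpsi_nat (bim_runit Co coflatC X) (bimodule_id R Z).
have nat2 := bt_mapE Co (bimodule_id R X) (bim_lunit Co coflatC Z).
rewrite -(bt_runitE Co X) tens_compl tens_compr ?compA.
rewrite (post3 (bpsi_frobr X bunit Z)) ?compA.
rewrite -[X in X ∘ bt_assoc_inv _ _ _ _ _]nat1 -tri ?compA.
rewrite (post2 (bt_assocVK _ _ _ _ _)) compfi (post2 nat2).
by rewrite -!compA -tens_comp bt_lunitVK compfi tens_id compfi.
Qed.

(** Both unit constraints of [bunit] descend from [amul]. This reconciles [psi_copair], built with
    the right one, with [bpsi_bqr], which produces the left one. *)
Lemma bt_unit_inv : bt_lunit_inv Co bunit = bt_runit_inv Co bunit.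
Proof.
have e : bt_lunit Co bunit = bt_runit Co bunit.
  by apply: (bq_epi Co); rewrite bt_lunitE bt_runitE.
rewrite -[LHS]compfi -(bt_runitVK Co bunit) -e compA.
by rewrite (bt_lunitK Co bunit) compif.
Qed.

Lemma bpsi_rcoact X : bpsi X bunit ∘ bt_runit_inv Co X = rcoact psi_copair (bim_ract X).
Proof.
rewrite /bt_runit_inv ?compA bpsi_bqr bt_unit_inv /rcoact /psi_copair.
by rewrite (post2 (esym (tens_compr _ _))).
Qed.

Lemma bpsi_insertion X Y :
  bpsi X Y ∘ bq Co X Y = insertion psi_copair (bim_ract X) (bim_lact Y).
Proof. by rewrite bpsi_bql bpsi_rcoact. Qed.

Lemma psi_frobenius_pair : frobenius_pair R (psi0 psi) psi_copair.
Proof.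
split; last split.
(* The two sides of the Casimir equation are the expansions of one map, psi at [bunit], [bunit]
   after the inverse unit constraint, by [bpsi_bqr] and by [bpsi_bql]. *)
- rewrite -[LHS]/(rcoact psi_copair (bim_ract bunit)) -bpsi_rcoact -bt_unit_inv.
  rewrite /bt_lunit_inv ?compA bpsi_bql.
  by rewrite (post2 (esym (tens_compl _ _))).
- have u : lunit R ∘ (psi0 psi ⊗₁ idm R) ∘ bpsi bunit bunit = bt_lunit Co bunit.
    exact: (psi2_unitl _ psi bunit).
  (* Both actions of [bunit] are [amul], so the right unit law serves here too. *)
  by rewrite /psi_copair ?compA u bt_lunitE (bim_ract1 bunit) runitVK compif.
- have u : runit R ∘ (idm R ⊗₁ psi0 psi) ∘ bpsi bunit bunit = bt_runit Co bunit.
    exact: (psi2_unitr _ psi bunit).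
  by rewrite /psi_copair ?compA u bt_runitE (bim_ract1 bunit) runitVK compif.
Qed.

End PairOfOpmonoidal.

Theorem theorem5p4 (C : monoidal_category) (Co : has_coequalizers C)
  (coflatC : forall X : C, coflat X)
  (robustC : forall (S : algebra C) (Y : left_module S), left_robust Co Y)
  (R : algebra C) :
  ((exists psi : opmonoidal_structure (forgetful Co coflatC R),
      frobenius_monoidal (forgetful_monoidal Co coflatC R) psi)
   <-> frobenius_algebra R)
  /\
  (forall psi : opmonoidal_structure (forgetful Co coflatC R),
     frobenius_monoidal (forgetful_monoidal Co coflatC R) psi ->
     exists (theta : hom R 𝟏) (e : hom 𝟏 (R ⊗ R)),
       frobenius_pair R theta e /\
       psi0 psi = theta /\
       forall X Y : bimodule R,
         psi2 psi X Y ∘ qmap Co X Y =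
         (bim_ract X ⊗₁ bim_lact Y) ∘ assoc (X ⊗ R) R Y ∘
           (assoc_inv X R R ⊗₁ idm (Y : C)) ∘
           ((idm (X : C) ⊗₁ e) ⊗₁ idm (Y : C)) ∘
           (runit_inv X ⊗₁ idm (Y : C))).
Proof.
split; first split.
- move=> [psi frob]; exists (psi0 psi), (psi_copair Co coflatC psi).
  exact: psi_frobenius_pair.
- move=> [theta [e fp]]; exists (forgetful_opmonoidal Co coflatC fp).
  exact: forgetful_frobenius.
- move=> psi frob; exists (psi0 psi), (psi_copair Co coflatC psi).
  split; first exact: psi_frobenius_pair.
  split=> // X Y.
  exact: (etrans (bpsi_insertion Co coflatC psi frob X Y) (insertionE _ _ _)).
Qed.
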